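(* Let $m\ge2$ and let $\{\gamma_{ij}\}$ be a connected interconnection of locally Lipschitz functions. For $\omega>0$ consider the array of coupled harmonic oscillators $$\dot q_i=\omega p_i,\qquad \dot p_i=-\omega q_i+\sum_{j\ne i}\gamma_{ij}(p_j-p_i),\qquad i=1,\ldots,m,$$ with $\xi_i=[q_i\ p_i]^T\in\mathbb{R}^2$, regarded as a system in $\mathbb{R}^{2m}$ with state $\xi=[\xi_1^T\ \cdots\ \xi_m^T]^T$ and parameter $\omega$. Then the synchronization manifold $$\mathcal{A}:=\{\eta=[\eta_1^T\ \cdots\ \eta_m^T]^T\in\mathbb{R}^{2m}:\ \eta_i\in\mathbb{R}^2,\ \eta_i=\eta_j\ \text{for all } i,j\}$$ is semiglobally practically asymptotically stable (with respect to $\omega$).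
   Context: $|\cdot|$ is the Euclidean norm; for a closed set $\mathcal{S}\subset\mathbb{R}^n$, $|x|_{\mathcal{S}}$ is the Euclidean distance from $x$ to $\mathcal{S}$. A function $\alpha:\mathbb{R}_{\ge0}\to\mathbb{R}_{\ge0}$ is of class $\mathcal{K}$ if it is continuous, zero at zero and strictly increasing. Interconnection: a set of functions $\{\gamma_{ij}:\mathbb{R}\to\mathbb{R}\}$, $i,j=1,\ldots,m$, $i\neq j$, such that for all $i,j$: (G1) $\gamma_{ij}(0)=0$ and $s\gamma_{ij}(s)\ge0$ for all $s\in\mathbb{R}$; (G2) either $\gamma_{ij}\equiv0$, or there exists $\alpha$ of class $\mathcal{K}$ with $|\gamma_{ij}(s)|\ge\alpha(|s|)$ for all $s\in\mathbb{R}$. Its graph has nodes $n_1,\ldots,n_m$ and a directed edge $(n_i,n_j)$ iff $\gamma_{ij}\not\equiv0$. The interconnection is connected if its graph has a node to which there is a directed path from every other node. Semiglobal practical asymptotic stability: for a system $\dot x=g(x,\omega,t)$, a closed set $\mathcal{S}$ is semiglobally practically asymptotically stable (with respect to $\omega$) if for each pair $(\Delta,\delta)$ of positive numbers there exists $\omega^*>0$ such that for all $\omega\ge\omega^*$ the following hold (for solutions $x(\cdot)$ with initial time $t_0$): (a) for each $r>\delta$ there exists $\varepsilon>0$ such that $|x(t_0)|_{\mathcal{S}}\le\varepsilon\Rightarrow|x(t)|_{\mathcal{S}}\le r$ for all $t\ge t_0$; (b) for each $\varepsilon<\Delta$ there exists $r>0$ such that $|x(t_0)|_{\mathcal{S}}\le\varepsilon\Rightarrow|x(t)|_{\mathcal{S}}\le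 r$ for all $t\ge t_0$; (c) for each $r<\Delta$ and $\varepsilon>\delta$ there exists $T>0$ such that $|x(t_0)|_{\mathcal{S}}\le r\Rightarrow|x(t)|_{\mathcal{S}}\le\varepsilon$ for all $t\ge t_0+T$. *)

(* Defs.v *)
From HB Require Import structures.
From mathcomp Require Import all_boot all_order all_algebra.
From mathcomp Require Import all_classical all_reals all_analysis.

Set Implicit Arguments.
Unset Strict Implicit.
Unset Printing Implicit Defensive.

Import Order.TTheory GRing.Theory Num.Theory.
Import numFieldNormedType.Exports.

Local Open Scope classical_set_scope.
Local Open Scope ring_scope.

(* The norm `|x| of 'rV[R]_n is the sup norm, hence the explicit formula; both
   norms give the same topology and the same derivatives. *)
Definition eucl_norm (R : realType) (n : nat) (x : 'rV[R]_n) : R :=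
  Num.sqrt (\sum_(k < n) x ord0 k ^+ 2).

Definition eucl_dist (R : realType) (n : nat) (S : set 'rV[R]_n)
    (x : 'rV[R]_n) : R :=
  inf [set eucl_norm (x - y) | y in S].

Definition locally_lipschitz (R : realType) (f : R -> R) : Prop :=
  forall x : R, exists2 U : set R, nbhs x U & [lipschitz f y | y in U].

(* Only the restriction of alpha to [0, +oo[ matters; it is nonnegative there
   because it vanishes at 0 and increases. *)
Definition class_K (R : realType) (alpha : R -> R) : Prop :=
  [/\ {within [set s | 0 <= s], continuous alpha},
      alpha 0 = 0 &
      forall s t, 0 <= s -> s < t -> alpha s < alpha t].

(* The diagonal functions gamma i i are junk: no definition below looks at
   them. *)
Definition interconnection (R : realType) (m : nat)
    (gamma : 'I_m -> 'I_m -> R -> R) : Prop :=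
  forall i j, i != j ->
    [/\ gamma i j 0 = 0,
        forall s, 0 <= s * gamma i j s &
        (forall s, gamma i j s = 0) \/
        (exists2 alpha, class_K alpha &
           forall s, alpha `|s| <= `|gamma i j s|)].

Definition edge (R : realType) (m : nat) (gamma : 'I_m -> 'I_m -> R -> R) :
    rel 'I_m :=
  [rel i j | (i != j) && ~~ `[< forall s, gamma i j s = 0 >] ].

Definition connected_interconnection (R : realType) (m : nat)
    (gamma : 'I_m -> 'I_m -> R -> R) : Prop :=
  exists c : 'I_m, forall i, i != c -> connect (edge gamma) i c.

(* x solves x' = f(x, t) on [t0, b[ with b in ]t0, +oo]; values of x outside
   this interval are irrelevant. The derivative is the two-sided one on
   ]t0, b[, continuity takes care of the initial time. *)
Definition time_interval (R : realType) (t0 : R) (b : \bar R) : set R :=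
  [set t | t0 <= t /\ (t%:E < b)%E].

Definition solution (R : realType) (n : nat)
    (f : 'rV[R]_n -> R -> 'rV[R]_n) (t0 : R) (b : \bar R)
    (x : R -> 'rV[R]_n) : Prop :=
  [/\ (t0%:E < b)%E,
      {within time_interval t0 b, continuous x} &
      forall t : R, t0 < t -> (t%:E < b)%E ->
        is_derive t (1 : R) x (f (x t) t)].

Definition maximal_solution (R : realType) (n : nat)
    (f : 'rV[R]_n -> R -> 'rV[R]_n) (t0 : R) (b : \bar R)
    (x : R -> 'rV[R]_n) : Prop :=
  solution f t0 b x /\
  ~ (exists b' y, [/\ (b < b')%E, solution f t0 b' y &
       forall t, time_interval t0 b t -> y t = x t]).

(* |x(t0)|_S <= a implies |x(t)|_S <= c for all t >= t0 + T. That x(t) exists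
   for all these t is part of the claim (no finite escape time). *)
Definition confined_after (R : realType) (n : nat)
    (f : 'rV[R]_n -> R -> 'rV[R]_n) (S : set 'rV[R]_n) (a c T : R) : Prop :=
  forall (t0 : R) (b : \bar R) (x : R -> 'rV[R]_n),
    maximal_solution f t0 b x -> eucl_dist S (x t0) <= a ->
    forall t, t0 + T <= t -> (t%:E < b)%E /\ eucl_dist S (x t) <= c.

Definition semiglobally_practically_asymptotically_stable
    (R : realType) (n : nat) (g : 'rV[R]_n -> R -> R -> 'rV[R]_n)
    (S : set 'rV[R]_n) : Prop :=
  closed S /\
  forall Delta delta : R, 0 < Delta -> 0 < delta ->
    exists2 omega_star : R, 0 < omega_star &
      forall omega, omega_star <= omega ->
        let f := fun x t => g x omega t in
        [/\ forall r, delta < r ->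
              exists2 eps, 0 < eps & confined_after f S eps r 0,
            forall eps, eps < Delta ->
              exists2 r, 0 < r & confined_after f S eps r 0 &
            forall r eps, r < Delta -> delta < eps ->
              exists2 T, 0 < T & confined_after f S r eps T].

(* R^(2m) is 'rV_(m * 2), identified through vec_mx with the m x 2 matrices
   whose i-th row is xi_i = (q_i, p_i). *)
Definition position (R : realType) (m : nat) (xi : 'rV[R]_(m * 2)) (i : 'I_m) : R :=
  vec_mx xi i ord0.

Definition momentum (R : realType) (m : nat) (xi : 'rV[R]_(m * 2)) (i : 'I_m) : R :=
  vec_mx xi i ord_max.

Definition coupled_oscillators (R : realType) (m : nat)
    (gamma : 'I_m -> 'I_m -> R -> R)
    (xi : 'rV[R]_(m * 2)) (omega t : R) : 'rV[R]_(m * 2) :=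
  mxvec (\matrix_(i < m, k < 2)
    if k == ord0 then omega * momentum xi i
    else - (omega * position xi i) +
         \sum_(j < m | j != i) gamma i j (momentum xi j - momentum xi i)).

Definition synchronization_manifold (R : realType) (m : nat) :
    set 'rV[R]_(m * 2) :=
  [set eta | forall i j, row i (vec_mx eta) = row j (vec_mx eta)].
Arguments synchronization_manifold : clear implicits.

(* Main.v *)
Require Import Defs.
From mathcomp Require Import all_boot all_order all_algebra.
From mathcomp Require Import all_classical all_reals all_analysis.
From mathcomp Require Import ring lra.

(** The proof passes to the frame rotating with the uncoupled oscillators,
    [a_i = cos(omega t) q_i - sin(omega t) p_i] and
    [b_i = sin(omega t) q_i + cos(omega t) p_i], where the fast rotation
    disappears and only the couplings move the state:
    [a_i' = - sin(omega t) u_i], [b_i' = cos(omega t) u_i], with [u_i] the sum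
    of the [gamma i j] at the projection of [(a_j - a_i, b_j - b_i)] on the
    rotating direction [(- sin(omega t), cos(omega t))].

    Averaging.  Freeze [w = (wa, wb)] and integrate the coupling over one period
    [tau = 2 pi / omega].  If [G] is a primitive of [gamma], then [G] of the
    projection of [w] is periodic; its derivative is [omega] times the pairing
    of the integrand with [w] turned by a right angle, hence the integral is
    parallel to [w]: it is [tau kappa w].  The sign condition and the Lipschitz
    bound give [0 <= kappa <= L], and a class K lower bound keeps [kappa] above a positive
    [c rho] as soon as [w] has length at least [rho] ([averaged_coupling]).
    Unfreezing [w] costs [O(tau^2)].  So, sampled once per period, each of the
    two coordinates follows a scalar consensus iteration with weights
    [tau kappa] and an error [O(tau^2)] per step ([period_step]).

    Consensus.  Take the spread (largest minus smallest value) of one coordinate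
    and the root [r] of the graph.  One of the two extremes is at a distance of
    at least half the spread from [x r]; say it is the maximum [M].  The gaps
    [Y i = M - x i], corrected for the accumulated error, are nonnegative
    supersolutions of the consensus iteration.  The gap at [r] keeps at
    least half of its value over a suitable block of periods, and travels along
    the edges: a node whose
    gap is small compared with that of a node it listens to is pushed away from
    [M] at a definite rate.  After at most [m] stages every gap exceeds a level
    which depends on a lower bound of the spread but not on [tau], so the spread decreases by a
    definite amount over the block ([spread_block]).  For small [tau] this beats
    the accumulated errors until the spread is as small as desired
    ([spread_consensus], [rotating_spread]).

    Global existence.  These estimates assume an a priori bound on the spread,
    but return a strictly better one, so the bound persists by continuity as
    long as the solution exists ([solution_trapped]).  The couplings then only
    see bounded arguments, where they agree with globally Lipschitz saturated
    couplings; by Picard iteration for the latter a solution can be continued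
    past any finite time, so maximal solutions are global
    ([maximal_solution_global]).  The distance to the synchronization manifold
    and the spreads in the rotating frame bound each other, which translates the
    estimates into the three required properties. *)

Set Implicit Arguments.
Unset Strict Implicit.
Unset Printing Implicit Defensive.

Import Order.TTheory GRing.Theory Num.Theory.
Import numFieldNormedType.Exports.

Local Open Scope classical_set_scope.
Local Open Scope ring_scope.

(** * Supersolutions of a consensus iteration *)

Lemma sum_others_le {R : realType} {m : nat} (F : 'I_m -> R) (k : R) (i : 'I_m) :
  0 <= k -> (forall j, j != i -> F j <= k) ->
  \sum_(j < m | j != i) F j <= m%:R * k.
Proof.
move=> k0 Fk; apply: (@le_trans _ _ (\sum_(j < m | j != i) k)).
  exact: ler_sum.
apply: (@le_trans _ _ (\sum_(j < m) k)).
  by rewrite [leRHS](bigID (fun j => j != i)) /= lerDl sumr_ge0.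
by rewrite sumr_const card_ord mulr_natl.
Qed.

Section Consensus.
Context {R : realType} {m : nat}.
Variables (e : rel 'I_m) (c : R -> R) (L tau : R).
Implicit Types (x Y : 'I_m -> R) (kappa : 'I_m -> 'I_m -> R).

(** The lower bound is required only for neighbours that are at least [rho] apart:
    a class K lower bound says nothing on the slope of a coupling at 0, so
    nearly synchronized neighbours may have weights arbitrarily close to 0. *)
Definition consensus_weights Y kappa : Prop := forall i j, i != j ->
  [/\ 0 <= kappa i j, kappa i j <= L &
      e i j -> forall rho, 0 < rho -> rho <= `|Y j - Y i| -> c rho <= kappa i j].

Definition consensus_increment kappa Y i : R :=
  \sum_(j < m | j != i) kappa i j * (Y j - Y i).

(** An inequality is enough on the side of a fixed upper bound: the gaps below
    that bound satisfy it even though the samples obey the iteration only up to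
    an error, and it is all that lower bounds on the gaps use. *)
Definition supersolution_step Y Y' : Prop :=
  exists2 kappa, consensus_weights Y kappa &
    forall i, Y i + tau * consensus_increment kappa Y i <= Y' i.

Definition consensus_step (E : R) x x' : Prop :=
  exists2 kappa, consensus_weights x kappa &
    forall i, `|x' i - x i - tau * consensus_increment kappa x i| <= E.

Hypotheses (L0 : 0 < L) (tau0 : 0 <= tau).

Lemma consensus_increment_ge kappa Y i : consensus_weights Y kappa ->
  (forall j, 0 <= Y j) ->
  \sum_(j < m | j != i) kappa i j * Y j - m%:R * L * Y i
    <= consensus_increment kappa Y i.
Proof.
move=> wk Y0; rewrite /consensus_increment.
under [leRHS]eq_bigr do rewrite mulrBr.
rewrite sumrB lerD2l lerN2 -mulr_suml ler_wpM2r //.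
apply: sum_others_le => [|j ji]; first exact: ltW.
by have [] := wk i j; rewrite // eq_sym.
Qed.

(** Nonnegative neighbours can only help, so at worst a node loses the fraction
    [tau m L] of its value. *)
Lemma supersolution_step_ge Y Y' i : supersolution_step Y Y' ->
  (forall j, 0 <= Y j) -> (1 - tau * (m%:R * L)) * Y i <= Y' i.
Proof.
move=> [kappa wk sk] Y0; apply: le_trans (sk i).
have := consensus_increment_ge i wk Y0.
have : 0 <= \sum_(j < m | j != i) kappa i j * Y j.
  apply: sumr_ge0 => j ji; rewrite mulr_ge0 //.
  by have [] := wk i j; rewrite // eq_sym.
move=> S0 /(ler_wpM2l tau0); have := mulr_ge0 tau0 S0; rewrite mulrBr; lra.
Qed.

Lemma supersolution_step_edge_ge Y Y' i j rho : supersolution_step Y Y' ->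
    (forall j, 0 <= Y j) -> e i j -> i != j -> 0 < rho ->
    rho <= `|Y j - Y i| ->
  (1 - tau * (m%:R * L)) * Y i + tau * c rho * Y j <= Y' i.
Proof.
move=> [kappa wk sk] Y0 eij ij rho0 rhoY; apply: le_trans (sk i).
have := consensus_increment_ge i wk Y0.
have : c rho * Y j <= \sum_(j < m | j != i) kappa i j * Y j.
  rewrite (bigD1 j) /=; last by rewrite eq_sym.
  rewrite -[leLHS]addr0 lerD //.
    by rewrite ler_wpM2r //; have [_ _] := wk i j ij; apply.
  apply: sumr_ge0 => k /andP[ki _]; rewrite mulr_ge0 //.
  by have [] := wk i k; rewrite // eq_sym.
move=> /(ler_wpM2l tau0) S0 /(ler_wpM2l tau0); rewrite mulrBr; lra.
Qed.

Variables (K : nat) (Y : nat -> 'I_m -> R).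
Hypothesis Ystep : forall k, (k < K)%N -> supersolution_step (Y k) (Y k.+1).
Hypothesis Y0 : forall i, 0 <= Y 0 i.
Hypothesis tauL : tau * (m%:R * L) <= 2^-1.

Let q0 : 0 <= tau * (m%:R * L).
Proof. by rewrite !mulr_ge0 // ?ler0n // ltW. Qed.

Lemma supersolution_ge0 k i : (k <= K)%N -> 0 <= Y k i.
Proof.
elim: k i => [|k IH] i kK //.
apply: le_trans (supersolution_step_ge i (Ystep kK) _).
  by rewrite mulr_ge0 ?IH ?(ltnW kK) //; move: tauL; lra.
by move=> j; exact/IH/ltnW.
Qed.

(** Bernoulli's inequality for the loss factor [1 - tau m L]. *)
Lemma supersolution_decay h i k : 0 <= h -> h <= Y 0 i -> (k <= K)%N ->
  (1 - k%:R * (tau * (m%:R * L))) * h <= Y k i.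
Proof.
move=> h0 hY; elim: k => [|k IH] kK; first by rewrite mul0r subr0 mul1r.
have Yk j : 0 <= Y k j by apply: supersolution_ge0; exact: ltnW.
apply: le_trans (supersolution_step_ge i (Ystep kK) Yk).
have {}IH := IH (ltnW kK).
apply: (@le_trans _ _ ((1 - tau * (m%:R * L)) *
    ((1 - k%:R * (tau * (m%:R * L))) * h))).
  rewrite [leRHS]mulrA ler_wpM2r // -natr1.
  by have := mulr_ge0 (ler0n R k) (mulr_ge0 q0 q0); lra.
by rewrite ler_wpM2l //; move: tauL; lra.
Qed.

(** A stage of the propagation along the graph lasts [4 * stage_scale]. The value
    is such that [m] stages, even after rounding up to whole periods, last at most
    [1 / (2 m L)], a time in which a node loses at most half of its value. *)
Definition stage_scale : R := (16 * (m%:R ^+ 2) * L)^-1.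
(** The value forced on a node by a neighbour that stays above [h] for one stage.
    The rate is taken at distance [h / 2]: as long as the node is below [h / 2],
    its neighbour is at least that far away. *)
Definition next_level (h : R) : R := stage_scale * c (h / 2) * h.

Hypothesis c_gt0 : forall rho, 0 < rho -> 0 < c rho.
Hypothesis c_le : forall rho, 0 < rho -> c rho <= L.
Hypothesis m0 : (0 < m)%N.

Let m1 : 1 <= m%:R :> R. Proof. by rewrite ler1n. Qed.

Lemma stage_scale_gt0 : 0 < stage_scale.
Proof. by rewrite invr_gt0 !mulr_gt0 // ?exprn_gt0 // ltr0n. Qed.

Lemma stage_scale_rate_le rho : 0 < rho ->
  m%:R * L * (stage_scale * c rho) <= 16^-1 * c rho
  /\ stage_scale * c rho <= 16^-1.
Proof.
move=> rho0; have m0' : 0 < m%:R :> R by rewrite ltr0n.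
have E : m%:R * L * stage_scale = 16^-1 * m%:R^-1.
  by rewrite /stage_scale; field; rewrite !gt_eqF.
have c0 := ltW (c_gt0 rho0).
have im : m%:R^-1 <= 1 :> R by rewrite invf_le1.
split.
  by rewrite mulrA E ler_wpM2r //; lra.
have -> : stage_scale * c rho = 16^-1 * (m%:R^-1 * m%:R^-1) * (c rho / L).
  by rewrite /stage_scale; field; rewrite !gt_eqF.
have cL : c rho / L <= 1 by rewrite ler_pdivrMr // mul1r c_le.
have cL0 : 0 <= c rho / L by rewrite divr_ge0 // ltW.
have im0 : 0 <= m%:R^-1 :> R by rewrite invr_ge0 ltW.
have : m%:R^-1 * m%:R^-1 <= 1 :> R by rewrite mulr_ile1.
have : 0 <= m%:R^-1 * m%:R^-1 :> R by rewrite mulr_ge0.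
move: (_ * _) => z z0 z1.
have : z * (c rho / L) <= 1 by rewrite mulr_ile1.
rewrite -mulrA; lra.
Qed.

Lemma next_level_gt0 h : 0 < h -> 0 < next_level h.
Proof. by move=> h0; rewrite !mulr_gt0 ?stage_scale_gt0 ?c_gt0 // divr_gt0. Qed.

Lemma next_level_le h : 0 < h -> next_level h <= h / 16.
Proof.
move=> h0; have h20 : 0 < h / 2 by rewrite divr_gt0.
by rewrite /next_level mulrC ler_pM2l //; have [] := stage_scale_rate_le h20.
Qed.

(** While node [i] is below twice the next level, the attraction towards [j] is at
    least [c (h / 2) * h] and dominates the loss; once above, a single step cannot
    bring it below the next level. *)
Lemma supersolution_push i j h k0 k : e i j -> i != j -> 0 < h ->
    (forall k, (k0 <= k <= K)%N -> h <= Y k j) -> (k0 <= k <= K)%N ->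
  Num.min (next_level h) ((k - k0)%:R * (tau * c (h / 2) * h / 4)) <= Y k i.
Proof.
move=> eij ij h0 hj /andP[]; elim: k => [|k IH].
  rewrite leqn0 => /eqP -> _.
  by rewrite subn0 mul0r ge_min supersolution_ge0 // orbT.
have h20 : 0 < h / 2 by rewrite divr_gt0.
have c0 := c_gt0 h20.
have th0 := next_level_gt0 h0; have th1 := next_level_le h0.
set th := next_level h in IH th0 th1 *.
set g := tau * c (h / 2) * h / 4 in IH *.
have g0 : 0 <= g by rewrite /g !mulr_ge0 ?invr_ge0 // ltW.
rewrite leq_eqVlt => /predU1P[-> kK|k0k kK].
  by rewrite subnn mul0r ge_min supersolution_ge0 // orbT.
have {}IH := IH k0k (ltnW kK).
have Yk l : 0 <= Y k l by apply: supersolution_ge0; exact: ltnW.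
have [lt2|ge2] := ltP (Y k i) (2 * th); last first.
  rewrite ge_min; apply/orP; left.
  apply: le_trans (supersolution_step_ge i (Ystep kK) Yk).
  apply: (@le_trans _ _ (2^-1 * (2 * th))); first lra.
  by apply: ler_pM => //; [lra|move: tauL; lra].
have hYj : h <= Y k j by apply: hj; rewrite -ltnS k0k ltnW.
have dY : h / 2 <= `|Y k j - Y k i|.
  by apply: le_trans (ler_norm _); lra.
have := supersolution_step_edge_ge (Ystep kK) Yk eij ij h20 dY.
apply: le_trans.
have : tau * c (h / 2) * h <= tau * c (h / 2) * Y k j.
  by rewrite ler_wpM2l // mulr_ge0 // ltW.
have -> : tau * c (h / 2) * h = 4 * g by rewrite /g; field.
have : tau * (m%:R * L) * Y k i <= g.
  apply: (@le_trans _ _ (tau * (m%:R * L) * (2 * th))).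
    by rewrite ler_wpM2l // ltW.
  have [+ _] := stage_scale_rate_le h20.
  have tauh : 0 <= 2 * (tau * h) by rewrite !mulr_ge0 // ltW.
  move=> /(ler_wpM2l tauh).
  have -> : 2 * (tau * h) * (m%:R * L * (stage_scale * c (h / 2))) =
     tau * (m%:R * L) * (2 * th) by rewrite /th /next_level; ring.
  have -> : 2 * (tau * h) * (16^-1 * c (h / 2)) = g / 2 by rewrite /g; field.
  lra.
have : Num.min th ((k.+1 - k0)%:R * g) <= Num.min th ((k - k0)%:R * g) + g.
  rewrite subSn // -natr1 mulrDl mul1r !minEle.
  case: ifP => A; case: ifP => B; move: A B; lra.
lra.
Qed.

(** One stage per edge of the path from [i] to [j]. *)
Lemma supersolution_path i p j (n1 : nat) h : path e i p -> last i p = j ->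
    (forall a b, e a b -> a != b) -> 4 * stage_scale <= n1%:R * tau ->
    (forall k, (k <= K)%N -> h <= Y k j) -> 0 < h ->
  forall k, (size p * n1 <= k <= K)%N -> iter (size p) next_level h <= Y k i.
Proof.
move=> + + ee n1tau hj h0; elim: p i => [|a p IH] i /=.
  by move=> _ -> k kK; exact: hj.
move=> /andP[eia pap] lp k /andP[nk kK]; have {}IH := IH a pap lp.
set h' := iter (size p) next_level h in IH *.
have h'0 : 0 < h'.
  by rewrite /h'; elim: (size p) => //= n; exact: next_level_gt0.
have spk : (size p * n1 <= k)%N by apply: leq_trans nk; rewrite mulSn leq_addl.
have := supersolution_push eia (ee _ _ eia) h'0 IH.
move=> /(_ k); rewrite spk kK => /(_ isT); apply: le_trans.
rewrite le_min lexx /= /next_level.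
have : n1%:R <= (k - size p * n1)%:R :> R.
  by rewrite ler_nat leq_subRL // addnC -mulSn.
have c0 : 0 <= c (h' / 2) by rewrite ltW // c_gt0 // divr_gt0.
move=> /(@ler_wpM2r _ (tau * c (h' / 2) * h' / 4)) n1k.
apply: le_trans (n1k _); last by rewrite !mulr_ge0 ?invr_ge0 // ltW.
have -> : n1%:R * (tau * c (h' / 2) * h' / 4) =
  (n1%:R * tau) * (c (h' / 2) * h' / 4) by ring.
have -> : stage_scale * c (h' / 2) * h' = 4 * stage_scale * (c (h' / 2) * h' / 4) by field.
by rewrite ler_wpM2r // !mulr_ge0 ?invr_ge0 // ltW.
Qed.

Lemma iter_next_level_le h a b : 0 < h -> (a <= b)%N ->
  iter b next_level h <= iter a next_level h.
Proof.
move=> h0; elim: b => [|b IH]; first by rewrite leqn0 => /eqP ->.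
rewrite leq_eqVlt => /predU1P[-> //|]; rewrite ltnS => /IH.
apply: le_trans => /=.
have hb : 0 < iter b next_level h.
  by elim: (b) => //= n; exact: next_level_gt0.
by have := next_level_le hb; lra.
Qed.

(** The root keeps half of its initial value during the whole block, and every node
    reaches the root by a path without repetition, hence of fewer than [m] edges. *)
Lemma supersolution_block (r : 'I_m) (n1 : nat) h :
    (forall i, i != r -> connect e i r) ->
    (forall a b, e a b -> a != b) -> 4 * stage_scale <= n1%:R * tau ->
    (m * n1)%:R * (tau * (m%:R * L)) <= 2^-1 -> K = (m * n1)%N ->
    0 < h -> 2 * h <= Y 0 r ->
  forall i, iter m next_level h <= Y K i.
Proof.
move=> er ee n1tau Kq KE h0 hr i.
have hj k : (k <= K)%N -> h <= Y k r.
  move=> kK; have h20 : 0 <= 2 * h by rewrite mulr_ge0 // ltW.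
  apply: le_trans (supersolution_decay h20 hr kK).
  have : k%:R * (tau * (m%:R * L)) <= 2^-1.
    by apply: le_trans Kq; rewrite -KE ler_wpM2r // ler_nat.
  by move: (_ * (tau * _)) => z z1; have := ler_wpM2r (ltW h0) z1; lra.
have /connectP[p0 pp0 lp0] : connect e i r.
  by have [->|/er] := eqVneq i r; [exact: connect0|].
case: (shortenP pp0) lp0 => p pp up _ lp.
have sp : (size p < m)%N.
  by have /card_uniqP /= <- := up; rewrite -[leqRHS]card_ord max_card.
apply: (le_trans (iter_next_level_le h0 (ltnW sp))).
apply: (supersolution_path pp (esym lp) ee n1tau hj h0).
by rewrite leqnn andbT KE leq_mul2r (ltnW sp) orbT.
Qed.

End Consensus.

(** * Contraction of the spread *)

Definition spread_le (R : realType) (m : nat) (x : 'I_m -> R) (S : R) : Prop :=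
  forall i j, x i - x j <= S.

Section ConsensusSpread.
Context {R : realType} {m : nat}.
Variables (e : rel 'I_m) (c : R -> R) (L tau E : R).
Hypotheses (L0 : 0 < L) (tau0 : 0 <= tau) (E0 : 0 <= E).
Hypothesis tauL : tau * (m%:R * L) <= 2^-1.

Lemma consensus_step_opp x x' : consensus_step e c L tau E x x' ->
  consensus_step e c L tau E (fun i => - x i) (fun i => - x' i).
Proof.
move=> [kappa wk sk]; exists kappa.
  move=> i j ij; have [k0 kL ke] := wk i j ij; split=> // eij rho rho0.
  by rewrite -opprD normrN => ?; exact: ke.
move=> i; rewrite -normrN; apply: le_trans (sk i).
rewrite le_eqVlt; apply/orP; left; apply/eqP; congr `|_|.
rewrite /consensus_increment.
under eq_bigr do rewrite -opprD mulrN.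
by rewrite sumrN; ring.
Qed.

(** The bound [M] is raised by [E] at each step, which absorbs the error of the
    iteration. *)
Lemma consensus_step_supersolution x x' (k : nat) M :
  consensus_step e c L tau E x x' ->
  supersolution_step e c L tau (fun i => M + k%:R * E - x i)
                               (fun i => M + k.+1%:R * E - x' i).
Proof.
move=> [kappa wk sk]; have YE a b : M + k%:R * E - x b - (M + k%:R * E - x a)
  = - (x b - x a) by ring.
exists kappa.
  move=> i j ij; have [k0 kL ke] := wk i j ij; split=> // eij rho rho0.
  by rewrite YE normrN => ?; exact: ke.
move=> i; have := sk i; rewrite /consensus_increment ler_norml => /andP[_].
under [X in _ -> _ + tau * X <= _]eq_bigr do rewrite YE mulrN.
by rewrite sumrN -natr1; lra.
Qed.

Section OneSequence.
Variables (K : nat) (x : nat -> 'I_m -> R).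
Hypothesis xstep : forall k, (k < K)%N -> consensus_step e c L tau E (x k) (x k.+1).

Lemma consensus_le M k i : (forall i, x 0%N i <= M) -> (k <= K)%N ->
  x k i <= M + k%:R * E.
Proof.
move=> xM kK; rewrite -subr_ge0.
apply: (@supersolution_ge0 _ _ e c L tau L0 tau0 K
    (fun k i => M + k%:R * E - x k i)) => //.
- by move=> l /xstep; exact: consensus_step_supersolution.
- by move=> j; rewrite mul0r addr0 subr_ge0.
Qed.

Hypothesis c_gt0 : forall rho, 0 < rho -> 0 < c rho.
Hypothesis c_le : forall rho, 0 < rho -> c rho <= L.
Variables (r : 'I_m) (n1 : nat).
Hypothesis er : forall i, i != r -> connect e i r.
Hypothesis ee : forall a b, e a b -> a != b.
Hypothesis n1tau : 4 * stage_scale (m := m) L <= n1%:R * tau.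
Hypothesis n1L : (m * n1)%:R * (tau * (m%:R * L)) <= 2^-1.

Lemma consensus_block_le M h i : K = (m * n1)%N -> (forall i, x 0%N i <= M) ->
    0 < h -> x 0%N r <= M - 2 * h ->
  x K i <= M + K%:R * E - iter m (next_level (m := m) c L) h.
Proof.
move=> KE xM h0 xr.
have := @supersolution_block _ _ e c L tau L0 tau0 K
    (fun k i => M + k%:R * E - x k i).
move=> /(_ _ _ tauL c_gt0 c_le _ r n1 h er ee n1tau n1L KE h0) H.
suff : iter m (next_level (m := m) c L) h <= M + K%:R * E - x K i by lra.
apply: H.
- by move=> l /xstep; exact: consensus_step_supersolution.
- by move=> j; rewrite mul0r addr0 subr_ge0.
- exact: leq_ltn_trans (ltn_ord r).
- by rewrite mul0r; lra.
Qed.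
End OneSequence.

Lemma spread_le_bounds (r : 'I_m) (x : 'I_m -> R) S : spread_le x S ->
  exists2 M, forall i, x i <= M & forall i, - x i <= S - M.
Proof.
move=> xS; exists (x [arg max_(i > r) x i]%O) => i;
  case: arg_maxP => // j _ xj; first exact: xj.
by have := xS j i; lra.
Qed.

Lemma spread_growth K x S (r : 'I_m) k :
    (forall k, (k < K)%N -> consensus_step e c L tau E (x k) (x k.+1)) ->
    spread_le (x 0%N) S -> (k <= K)%N ->
  spread_le (x k) (S + 2 * (k%:R * E)).
Proof.
move=> xstep xS kK i j; have [M xM xm] := spread_le_bounds r xS.
have := consensus_le (x := x) xstep i xM kK.
have := @consensus_le K (fun k i => - x k i)
  (fun k kK => consensus_step_opp (xstep k kK)) _ k j xm kK.
lra.
Qed.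

Hypothesis c_gt0 : forall rho, 0 < rho -> 0 < c rho.
Hypothesis c_le : forall rho, 0 < rho -> c rho <= L.
Variables (r : 'I_m) (n1 : nat).
Hypothesis er : forall i, i != r -> connect e i r.
Hypothesis ee : forall a b, e a b -> a != b.
Hypothesis n1tau : 4 * stage_scale (m := m) L <= n1%:R * tau.
Hypothesis n1L : (m * n1)%:R * (tau * (m%:R * L)) <= 2^-1.

(** The amount by which one block lowers a spread of at least [d]. Half of the
    spread separates the root from one of the extremes, and the root may lose half
    of that, whence [d / 4]. *)
Definition block_gain (d : R) : R := iter m (next_level (m := m) c L) (d / 4).

(** The root lies in the lower or in the upper half of the range. In the first case
    the maximum decreases, in the second the minimum increases, while the other
    extreme moves only by the accumulated error. *)
Lemma spread_block x S d :
    (forall k, (k < m * n1)%N -> consensus_step e c L tau E (x k) (x k.+1)) ->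
    spread_le (x 0%N) S -> 0 < d -> d <= S ->
  spread_le (x (m * n1)%N) (S + 2 * ((m * n1)%:R * E) - block_gain d).
Proof.
move=> xstep xS d0 dS i j; have [M xM xm] := spread_le_bounds r xS.
have d40 : 0 < d / 4 by rewrite divr_gt0.
have xstepN := fun k kK => consensus_step_opp (xstep k kK).
have [xr|xr] := leP (x 0%N r) (M - S / 2).
  have xrd : x 0%N r <= M - 2 * (d / 4) by lra.
  have := consensus_block_le xstep c_gt0 c_le er ee n1tau n1L i erefl xM d40 xrd.
  have := @consensus_le (m * n1) (fun k i => - x k i) xstepN _ _ j xm (leqnn _).
  rewrite /block_gain; lra.
have xrd : - x 0%N r <= S - M - 2 * (d / 4) by lra.
have := @consensus_block_le _ (fun k i => - x k i) xstepN c_gt0 c_le r n1 er ee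
  n1tau n1L _ _ j erefl xm d40 xrd.
have := consensus_le xstep i xM (leqnn _).
rewrite /block_gain; lra.
Qed.

Lemma block_gain_gt0 d : 0 < d -> 0 < block_gain d.
Proof.
move=> d0; have m0 : (0 < m)%N by exact: leq_ltn_trans (ltn_ord r).
suff iter_gt0 n : 0 < iter n (next_level (m := m) c L) (d / 4) by exact: iter_gt0.
elim: n => [|n IH] /=; first by rewrite divr_gt0.
exact: next_level_gt0.
Qed.

(** Blocks are iterated until the spread falls below [d]; from then on it cannot
    leave a neighbourhood of [d], because each block brings it back. *)
Lemma spread_consensus K x S d :
    (forall k, (k < K)%N -> consensus_step e c L tau E (x k) (x k.+1)) ->
    spread_le (x 0%N) S -> 0 < d -> d <= S ->
    (m * n1)%:R * E <= block_gain d / 4 ->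
  forall n k, (n * (m * n1) <= k <= K)%N ->
  spread_le (x k) (Num.max d (S - n%:R * (block_gain d / 2)) + block_gain d / 2).
Proof.
move=> xstep xS d0 dS NE; have g0 := block_gain_gt0 d0.
set g := block_gain d in NE g0 *; set N := (m * n1)%N in NE *.
have N0 : (0 < N)%N.
  have m0 : (0 < m)%N by exact: leq_ltn_trans (ltn_ord r).
  rewrite muln_gt0 m0 lt0n; apply/eqP => n10.
  by move: n1tau; rewrite n10 mul0r; have := @stage_scale_gt0 _ m L L0 m0; lra.
have blocks n : (n * N <= K)%N ->
    spread_le (x (n * N)%N) (Num.max d (S - n%:R * (g / 2))).
  elim: n => [|n IH] nK.
    by move=> i j; rewrite mul0n mul0r subr0 max_r.
  have nK' : (n * N <= K)%N by apply: leq_trans nK; rewrite leq_mul2r leqnSn orbT.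
  have := @spread_block (fun k => x (n * N + k)%N)
    (Num.max d (S - n%:R * (g / 2))) d.
  rewrite addn0 -/N -mulSnr le_max lexx -/g => H i j.
  have st k : (k < N)%N -> consensus_step e c L tau E (x (n * N + k)%N) (x (n * N + k.+1)%N).
    move=> kN; rewrite addnS; apply: xstep; apply: leq_trans nK.
    by rewrite mulSnr ltn_add2l.
  apply: le_trans (H st (IH nK') d0 isT i j) _.
  rewrite -(natr1 n) le_max.
  by case: (leP d (S - n%:R * (g / 2))) => _; apply/orP; [right|left]; lra.
move=> n k /andP[nk kK] i j.
have kd : (k %/ N * N <= K)%N by apply: leq_trans kK; exact: leq_trunc_div.
have := @spread_growth (K - k %/ N * N) (fun l => x (k %/ N * N + l)%N)
   (Num.max d (S - (k %/ N)%:R * (g / 2))) r (k %% N) _ _ _ i j.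
rewrite addn0 -divn_eq => H.
apply: le_trans (H _ _ _) _.
- move=> l lK; rewrite addnS; apply: xstep.
  by rewrite -ltn_subRL.
- exact: blocks.
- by rewrite -(leq_add2l (k %/ N * N)) -divn_eq subnKC.
apply: lerD.
  rewrite ge_max !le_max lexx /=; apply/orP; right.
  rewrite lerD2l lerN2 ler_wpM2r ?ler_nat ?leq_divRL // ltW // divr_gt0 //.
have : (k %% N)%:R * E <= N%:R * E.
  by rewrite ler_wpM2r // ler_nat ltnW // ltn_pmod.
lra.
Qed.

End ConsensusSpread.

(** * One-variable calculus *)

Section RealAnalysis.
Context {R : realType}.
Implicit Types (f g df : R -> R).

Lemma is_derive_fctD f g (t a b : R) : is_derive t 1 f a -> is_derive t 1 g b ->
  is_derive t 1 (fun t => f t + g t) (a + b).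
Proof. by move=> fa gb; exact: is_deriveD. Qed.

Lemma is_derive_fctB f g (t a b : R) : is_derive t 1 f a -> is_derive t 1 g b ->
  is_derive t 1 (fun t => f t - g t) (a - b).
Proof. by move=> fa gb; exact: is_deriveB. Qed.

Lemma is_derive_fctM f g (t a b : R) : is_derive t 1 f a -> is_derive t 1 g b ->
  is_derive t 1 (fun t => f t * g t) (f t * b + g t * a).
Proof. by move=> fa gb; exact: is_deriveM. Qed.

Lemma is_derive_fctMl (k : R) f (t a : R) : is_derive t 1 f a ->
  is_derive t 1 (fun t => k * f t) (k * a).
Proof. by move=> fa; exact: is_deriveZ. Qed.

Lemma is_derive_fct_sum (I : finType) (P : pred I) (F : I -> R -> R) (dF : I -> R)
    (t : R) : (forall i, P i -> is_derive t 1 (F i) (dF i)) ->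
  is_derive t 1 (fun t => \sum_(i | P i) F i t) (\sum_(i | P i) dF i).
Proof.
move=> FdF; rewrite -fct_sumE.
elim/big_ind2 : _ => //=; first exact: is_derive_cst.
by move=> F1 d1 F2 d2 ? ?; exact: is_deriveD.
Qed.

Lemma increment_le f df (a b k : R) : a <= b ->
    (forall t, a <= t <= b -> {for t, continuous f}) ->
    (forall t, a < t < b -> is_derive t 1 f (df t)) ->
    (forall t, a < t < b -> df t <= k) ->
  f b - f a <= k * (b - a).
Proof.
rewrite le_eqVlt => /predU1P[-> _ _ _|ab cf ff dfk]; first by rewrite !subrr mulr0.
have [|c cab ->] := @MVT R f df a b ab.
  by apply: continuous_in_subspaceT => t /[!inE]/=; rewrite in_itv; exact: cf.
by rewrite ler_wpM2r ?dfk // ?subr_ge0 ?ltW //; move: cab; rewrite in_itv.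
Qed.

Lemma increment_ge f df (a b k : R) : a <= b ->
    (forall t, a <= t <= b -> {for t, continuous f}) ->
    (forall t, a < t < b -> is_derive t 1 f (df t)) ->
    (forall t, a < t < b -> k <= df t) ->
  k * (b - a) <= f b - f a.
Proof.
rewrite le_eqVlt => /predU1P[-> _ _ _|ab cf ff dfk]; first by rewrite !subrr mulr0.
have [|c cab ->] := @MVT R f df a b ab.
  by apply: continuous_in_subspaceT => t /[!inE]/=; rewrite in_itv; exact: cf.
by rewrite ler_wpM2r ?dfk // ?subr_ge0 ?ltW //; move: cab; rewrite in_itv.
Qed.

Lemma increment_norm_le f df (a b k : R) : a <= b ->
    (forall t, a <= t <= b -> {for t, continuous f}) ->
    (forall t, a < t < b -> is_derive t 1 f (df t)) ->
    (forall t, a < t < b -> `|df t| <= k) ->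
  `|f b - f a| <= k * (b - a).
Proof.
move=> ab cf ff dfk; rewrite ler_norml -mulNr.
rewrite (increment_le ab cf ff) ?(increment_ge ab cf ff) // => t tab.
  by have := dfk t tab; rewrite ler_norml => /andP[].
by have := dfk t tab; rewrite ler_norml => /andP[].
Qed.

Lemma is_derive1_continuous f (t a : R) : is_derive t 1 f a -> {for t, continuous f}.
Proof. by move=> [fd _]; apply: differentiable_continuous; exact/derivable1_diffP. Qed.

(** The fundamental theorem of calculus gives primitives on half-lines; normalized
    at 0 they agree on their common domain, so they glue. *)
Lemma continuous_primitive g : continuous g ->
  exists G : R -> R, forall t : R, is_derive t 1 G (g t).
Proof.
move=> cg; pose I (n x : R) : R := (\int[lebesgue_measure]_(t in `[- n, x]) g t)%R.
have dI (n x : R) : - n < x -> is_derive x 1 (I n) (g x).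
  move=> nx; have nx1 : - n < x + 1 by lra.
  have [] := @continuous_FTC1_closed R g (- n) x (x + 1) _ _ nx (cg x).
  - lra.
  - apply: continuous_compact_integrable; first exact: segment_compact.
    exact: continuous_subspaceT.
  - by rewrite derive1E => d1 d2; apply: DeriveDef.
pose G (x : R) := I (`|x| + 1) x - I (`|x| + 1) 0; exists G => t.
have IE (n p x : R) : - n < x -> - p < x -> 0 < n -> 0 < p ->
    I n x - I n 0 = I p x - I p 0.
  move=> nx px n0 p0; pose D (y : R) := I n y - I p y.
  have dD (y : R) : - n < y -> - p < y -> is_derive y 1 D 0.
    by move=> ny py; rewrite -(subrr (g y)); apply: is_derive_fctB; exact: dI.
  suff : D x = D 0 by rewrite /D; lra.
  wlog : / (x <= 0) \/ (0 <= x) by apply; have [] := leP x 0; lra.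
  move=> x0.
  have bnd (a b : R) : a <= b -> - n < a -> - p < a -> D b = D a.
    move=> ab na pa; apply/eqP; rewrite -subr_eq0 -normr_le0.
    rewrite -(mul0r (b - a)); apply: (increment_norm_le (df := cst 0)) => //=.
    + move=> y /andP[ay yb]; apply: is_derive1_continuous; apply: dD; lra.
    + by move=> y /andP[ay yb]; apply: dD; lra.
    + by move=> y _; rewrite normr0.
  by case: x0 => x0; [apply/esym|]; apply: bnd => //; lra.
have t0 := normr_ge0 t; have tN := ler_norm (- t); rewrite normrN in tN.
apply: (@near_eq_is_derive _ _ _ (fun x => I (`|t| + 2) x - I (`|t| + 2) 0)).
- near=> x.
  have xt : `|x - t| < 1 by near: x; apply: cvgr_distC_lt => //; exact: cvg_id.
  have := ler_norm (- x); rewrite normrN => x0; have := normr_ge0 x => x00.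
  have := ler_normB t (t - x); rewrite opprB addrC subrK distrC => tx.
  by rewrite /G; apply: IE; lra.
- rewrite -[g t]subr0; apply: is_derive_fctB.
  apply: dI; lra.
Unshelve. all: by end_near. Qed.

(** The infimum of the counterexamples would itself allow one more step. *)
Lemma real_induction (P : R -> Prop) (a b : R) :
    (forall t, a <= t <= b -> (forall s, a <= s < t -> P s) ->
      exists2 eps, 0 < eps & forall s, t <= s < t + eps -> s <= b -> P s) ->
  forall t, a <= t <= b -> P t.
Proof.
move=> step; apply: contrapT => /existsNP[t0 /not_implyP[t0ab nPt0]].
pose B := [set t | a <= t <= b /\ ~ P t].
have Bt0 : B t0 by [].
have Blb : has_inf B by split; [exists t0|exists a => t [/andP[]]].
pose i := inf B.
have Bi t : B t -> i <= t by move=> Bt; apply: ge_inf => //; case: Blb.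
have ai : a <= i by apply: lb_le_inf; [exists t0|move=> t [/andP[]]].
have ib : i <= b by apply: (le_trans (Bi _ Bt0)); case/andP: t0ab.
have [|s /andP[as_ si]|eps eps0 Peps] := step i; first by rewrite ai.
  apply: contrapT => nPs; have : i <= s.
    by apply: Bi; split=> //; rewrite as_ (le_trans (ltW si)).
  lra.
have [t Bt] := inf_adherent eps0 Blb; rewrite -/i => ti.
have it := Bi t Bt; case: Bt => /andP[_ tb]; apply; apply: Peps => //.
by rewrite it.
Qed.

Lemma locally_lipschitzP f x : locally_lipschitz f ->
  exists d L : R, [/\ 0 < d, 0 < L & forall y z, `|y - x| < d -> `|z - x| < d ->
    `|f y - f z| <= L * `|y - z|].
Proof.
move=> /(_ x)[U /nbhs_ballP[d /= d0 dU] fU].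
have [L L0 LU] := pinfty_ex_gt0 fU.
exists d, L; split=> // y z yx zx; apply: (LU (y, z)); split; apply: dU.
  by rewrite /ball /= distrC.
by rewrite /ball /= distrC.
Qed.

Lemma locally_lipschitz_continuous f : locally_lipschitz f -> continuous f.
Proof.
move=> lf x; have [d [L [d0 L0 fL]]] := locally_lipschitzP x lf.
apply/cvgrPdist_le => /= e e0; near=> y.
have xy : `|x - y| < d by near: y; exact: cvgr_dist_lt.
have xyL : `|x - y| < e / L by near: y; apply: cvgr_dist_lt; rewrite ?divr_gt0.
have xx : `|x - x| < d by rewrite subrr normr0.
rewrite distrC in xy; apply: le_trans (fL x y xx xy) _.
by rewrite mulrC -ler_pdivlMr // ltW.
Unshelve. all: by end_near. Qed.

(** Real induction from the left end: a Lipschitz bound on an initial segment and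
    one near its end point combine into a bound on a longer segment. *)
Lemma locally_lipschitz_segment f (M : R) : 0 <= M -> locally_lipschitz f ->
  exists2 L, 0 < L & forall y z, `|y| <= M -> `|z| <= M ->
    `|f y - f z| <= L * `|y - z|.
Proof.
move=> M0 lf.
pose P t := exists2 L, 0 < L & forall y z, - M <= y <= t -> - M <= z <= t ->
  `|f y - f z| <= L * `|y - z|.
suff PM : forall t, - M <= t <= M -> P t.
  have [|L L0 fL] := PM M; first by lra.
  exists L => // y z; rewrite ler_norml => yM; rewrite ler_norml => zM.
  exact: fL.
apply: real_induction => t /andP[Mt tM] Pt.
have [d [L [d0 L0 fL]]] := locally_lipschitzP t lf.
have [L' L'0 fL'] : exists2 L', 0 < L' & forall y z, - M <= y <= t - d / 2 ->
    - M <= z <= t - d / 2 -> `|f y - f z| <= L' * `|y - z|.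
  have [Mtd|tdM] := leP (- M) (t - d / 2).
    by apply: Pt; rewrite Mtd; lra.
  by exists 1 => // y z; lra.
exists (d / 2); first by rewrite divr_gt0.
move=> s /andP[ts std] sM; exists (L + L'); first by rewrite addr_gt0.
have key y z : - M <= y -> y <= z -> z <= s ->
    `|f y - f z| <= (L + L') * `|y - z|.
  move=> My yz zs.
  have [yl|yl] := leP (t - d / 2) y.
    apply: (@le_trans _ _ (L * `|y - z|)).
      by apply: fL; rewrite ltr_norml; lra.
    by rewrite ler_wpM2r // lerDl ltW.
  have [zl|zl] := leP z (t - d / 2).
    apply: (@le_trans _ _ (L' * `|y - z|)).
      by apply: fL'; lra.
    by rewrite ler_wpM2r // lerDr ltW.
  rewrite -(subrK (f (t - d / 2)) (f y)) -addrA (le_trans (ler_normD _ _)) //.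
  have A : `|f y - f (t - d / 2)| <= L' * `|y - (t - d / 2)| by apply: fL'; lra.
  have B : `|f (t - d / 2) - f z| <= L * `|t - d / 2 - z|.
    by apply: fL; rewrite ltr_norml; lra.
  have t1 : y - (t - d / 2) <= 0 by lra.
  have t2 : t - d / 2 - z <= 0 by lra.
  have yz0 : y - z <= 0 by lra.
  rewrite (ler0_norm t1) in A; rewrite (ler0_norm t2) in B; rewrite (ler0_norm yz0).
  have := mulr_ge0_le0 (ltW L0) t1; have := mulr_ge0_le0 (ltW L'0) t2.
  lra.
move=> y z /andP[My ys] /andP[Mz zs]; have [yz|/ltW zy] := leP y z.
  exact: key.
by rewrite distrC (distrC y); exact: key.
Qed.

End RealAnalysis.

(** * Averaging one coupling over a period *)

Section Averaging.
Context {R : realType}.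
Implicit Types (wa wb omega t : R).

(** The component of [(wa, wb)] along the direction [(- sin, cos)] in which the
    couplings act in the rotating frame. *)
Definition projection omega wa wb t : R := cos (omega * t) * wb - sin (omega * t) * wa.

Lemma projection_norm_le omega wa wb t :
  `|projection omega wa wb t| <= `|wa| + `|wb|.
Proof.
apply: (le_trans (ler_normB _ _)); rewrite addrC !normrM.
by apply: lerD; apply: ler_piMl => //; rewrite ler_norml ?sin_geN1 ?sin_le1
  ?cos_geN1 ?cos_le1.
Qed.

Lemma is_derive_sin_omega omega t :
  is_derive t 1 (fun t => sin (omega * t)) (omega * cos (omega * t)).
Proof.
have ot : is_derive t (1 : R) (fun t => omega * t) (omega * 1).
  by apply: is_derive_fctMl; exact: is_derive_id.
apply: (is_derive_eq (is_derive1_comp (is_derive_sin _) ot)).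
by rewrite mulr1 mulrC.
Qed.

Lemma is_derive_cos_omega omega t :
  is_derive t 1 (fun t => cos (omega * t)) (- (omega * sin (omega * t))).
Proof.
have ot : is_derive t (1 : R) (fun t => omega * t) (omega * 1).
  by apply: is_derive_fctMl; exact: is_derive_id.
apply: (is_derive_eq (is_derive1_comp (is_derive_cos _) ot)).
by rewrite mulr1 mulNr mulrC.
Qed.

Lemma is_derive_projection omega wa wb t :
  is_derive t 1 (projection omega wa wb)
    (omega * (- (sin (omega * t) * wb) - cos (omega * t) * wa)).
Proof.
have ds := is_derive_sin_omega omega t; have dc := is_derive_cos_omega omega t.
have := is_derive_fctB (is_derive_fctMl wb dc) (is_derive_fctMl wa ds).
rewrite /projection.
under eq_fun do rewrite mulrC (mulrC wa).
by move=> d; apply: (is_derive_eq d); ring.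
Qed.

Lemma projection_period omega wa wb t : omega != 0 ->
  projection omega wa wb (t + 2 * pi / omega) = projection omega wa wb t.
Proof.
move=> o0; rewrite /projection.
have -> : omega * (t + 2 * pi / omega) = omega * t + pi *+ 2.
  by rewrite -mulr_natl; field.
by rewrite cosD2pi sinD2pi.
Qed.

Variable gamma : R -> R.
Hypotheses (gamma_cont : continuous gamma).
Hypothesis gamma_sign : forall s, 0 <= s * gamma s.

(** Three functions with explicit derivatives are compared over a period. The
    primitive of [gamma] along the projection is periodic, which shows that the
    average is parallel to [(wa, wb)]. The pairing of the average with [(wa, wb)]
    is the integral of [s * gamma s], with [s] the projection, and this lies
    between multiples of the integral of [s ^+ 2], which is [tau / 2] times the
    squared length. In the lower bound the threshold [rho ^+ 2 / 4] removes at most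
    half of that integral. *)
Lemma averaged_coupling omega wa wb t0 (D L : R) : 0 < omega -> 0 <= L ->
    let tau := 2 * pi / omega in
    `|wa| <= D -> `|wb| <= D ->
    (forall s, `|s| <= 2 * D -> `|gamma s| <= L * `|s|) ->
  exists kappa (Fa Fb : R -> R),
  [/\ [/\ 0 <= kappa, kappa <= L & forall rho c, 0 < rho ->
         (forall s, `|s| <= 2 * D -> c * (s ^+ 2 - rho ^+ 2 / 4) <= s * gamma s) ->
         0 <= c -> rho ^+ 2 <= wa ^+ 2 + wb ^+ 2 -> c / 4 <= kappa],
      forall t, is_derive t 1 Fa (- sin (omega * t) * gamma (projection omega wa wb t)),
      forall t, is_derive t 1 Fb (cos (omega * t) * gamma (projection omega wa wb t)),
      Fa (t0 + tau) - Fa t0 = tau * (kappa * wa) &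
      Fb (t0 + tau) - Fb t0 = tau * (kappa * wb)].
Proof.
move=> o0 L0 tau waD wbD gL; have o0' : omega != 0 by rewrite gt_eqF.
have tau0 : 0 < tau by rewrite divr_gt0 // mulr_gt0 // pi_gt0.
have otau : omega * (t0 + tau) = omega * t0 + pi *+ 2.
  by rewrite /tau -[pi *+ 2]mulr_natl; field.
have t0tau : t0 <= t0 + tau by rewrite lerDl ltW.
pose p := projection omega wa wb.
have dp t : is_derive t 1 p _ := is_derive_projection omega wa wb t.
have cp : continuous p by move=> t; exact: is_derive1_continuous (dp t).
have pD t : `|p t| <= 2 * D.
  by apply: (le_trans (projection_norm_le _ _ _ _)); lra.
have cgp : continuous (gamma \o p).
  by move=> t; apply: continuous_comp; [exact: cp|exact: gamma_cont].
have [Fa dFa] : exists Fa : R -> R, forall t,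
    is_derive t 1 Fa (- sin (omega * t) * gamma (p t)).
  apply: continuous_primitive => t.
  apply: (@continuousM _ _ (fun t => - sin (omega * t)) (gamma \o p)); last exact: cgp.
  apply: (@continuousN _ _ _ (fun t => sin (omega * t))).
  exact: is_derive1_continuous (is_derive_sin_omega _ _).
have [Fb dFb] : exists Fb : R -> R, forall t,
    is_derive t 1 Fb (cos (omega * t) * gamma (p t)).
  apply: continuous_primitive => t.
  apply: (@continuousM _ _ (fun t => cos (omega * t)) (gamma \o p)); last exact: cgp.
  exact: is_derive1_continuous (is_derive_cos_omega _ _).
pose A := Fa (t0 + tau) - Fa t0; pose B := Fb (t0 + tau) - Fb t0.
have ptau : p (t0 + tau) = p t0 by exact: projection_period.
(* The pairing with the direction orthogonal to (wa, wb) is a derivative. *)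
have perp : wa * B = wb * A.
  have [G dG] := continuous_primitive gamma_cont.
  pose H t := G (p t) + (omega * wa * Fb t - omega * wb * Fa t).
  have dH t : is_derive t 1 H 0.
    have := is_derive_fctD (is_derive1_comp (dG (p t)) (dp t))
      (is_derive_fctB (is_derive_fctMl (omega * wa) (dFb t))
                      (is_derive_fctMl (omega * wb) (dFa t))).
    by move=> d; apply: (is_derive_eq d); ring.
  have : `|H (t0 + tau) - H t0| <= 0 * (t0 + tau - t0).
    apply: (increment_norm_le (df := cst 0)) => //= t _.
      exact: is_derive1_continuous (dH t).
    by rewrite normr0.
  rewrite mul0r normr_le0 /H ptau => /eqP HH.
  have : omega * (wa * B - wb * A) = 0 by rewrite /A /B -[RHS]HH; ring.
  by move/eqP; rewrite mulf_eq0 (negbTE o0') /= subr_eq0 => /eqP.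
pose w2 := wa ^+ 2 + wb ^+ 2.
pose J t := wa * Fa t + wb * Fb t.
have dJ t : is_derive t 1 J (p t * gamma (p t)).
  have := is_derive_fctD (is_derive_fctMl wa (dFa t)) (is_derive_fctMl wb (dFb t)).
  by move=> d; apply: (is_derive_eq d); rewrite /p /projection; ring.
have JE : J (t0 + tau) - J t0 = wa * A + wb * B by rewrite /J /A /B; ring.
(* A primitive of the squared projection, which has mean w2 / 2. *)
pose Q t := w2 / 2 * t
  + (wb ^+ 2 - wa ^+ 2) / (2 * omega) * (sin (omega * t) * cos (omega * t))
  - wa * wb / omega * (sin (omega * t) * sin (omega * t)).
have dQ t : is_derive t 1 Q (p t ^+ 2).
  have ds := is_derive_sin_omega omega t; have dc := is_derive_cos_omega omega t.
  have := is_derive_fctB (is_derive_fctD (is_derive_fctMl (w2 / 2) (is_derive_id t 1))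
      (is_derive_fctMl ((wb ^+ 2 - wa ^+ 2) / (2 * omega)) (is_derive_fctM ds dc)))
      (is_derive_fctMl (wa * wb / omega) (is_derive_fctM ds ds)).
  move=> d; apply: (is_derive_eq d).
  have CS := cos2Dsin2 (omega * t); rewrite /p /projection /w2.
  move: (cos _) (sin _) CS => C S CS.
  apply/eqP; rewrite -subr_eq0; apply/eqP.
  transitivity ((wa ^+ 2 + wb ^+ 2) / 2 * (1 - (C ^+ 2 + S ^+ 2))); first by field.
  by rewrite CS subrr mulr0.
have JQ c k : (forall t, c * (p t ^+ 2) - k <= p t * gamma (p t)) ->
    c * (tau * w2 / 2) - k * tau <= wa * A + wb * B.
  move=> ck; pose D1 t := J t - c * Q t.
  have dD1 t : is_derive t 1 D1 (p t * gamma (p t) - c * p t ^+ 2).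
    exact: is_derive_fctB (dJ t) (is_derive_fctMl c (dQ t)).
  have := increment_ge (f := D1) (k := - k) t0tau
    (fun t _ => is_derive1_continuous (dD1 t)) (fun t _ => dD1 t).
  have -> : D1 (t0 + tau) - D1 t0 = wa * A + wb * B - c * (tau * w2 / 2).
    rewrite -JE /D1 /Q.
    by rewrite otau cosD2pi sinD2pi; ring.
  move=> H; have : - k * (t0 + tau - t0) <= wa * A + wb * B - c * (tau * w2 / 2).
    by apply: H => t _; have := ck t; lra.
  by rewrite addrAC subrr add0r; lra.
have JL : wa * A + wb * B <= L * (tau * w2 / 2).
  pose D1 t := J t - L * Q t.
  have dD1 t : is_derive t 1 D1 (p t * gamma (p t) - L * p t ^+ 2).
    exact: is_derive_fctB (dJ t) (is_derive_fctMl L (dQ t)).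
  have := increment_le (f := D1) (k := 0) t0tau
    (fun t _ => is_derive1_continuous (dD1 t)) (fun t _ => dD1 t).
  have -> : D1 (t0 + tau) - D1 t0 = wa * A + wb * B - L * (tau * w2 / 2).
    rewrite -JE /D1 /Q.
    by rewrite otau cosD2pi sinD2pi; ring.
  rewrite mul0r subr_le0; apply=> t _; rewrite subr_le0.
  apply: (le_trans (ler_norm _)); rewrite normrM.
  apply: le_trans (ler_wpM2l (normr_ge0 _) (gL _ (pD t))) _.
  by rewrite mulrCA -expr2 real_normK // num_real.
have w20 : 0 <= w2 by rewrite addr_ge0 // sqr_ge0.
(* For w = 0 the coupling vanishes and any weight in the interval [0, L] would do. *)
have [w2e|w2n] := eqVneq w2 0.
  move/eqP: w2e; rewrite paddr_eq0 ?sqr_ge0 // !sqrf_eq0 => /andP[/eqP wa0 /eqP wb0].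
  have p0 t : p t = 0 by rewrite /p /projection wa0 wb0 !mulr0 subrr.
  have g0 : gamma 0 = 0.
    apply/eqP; rewrite -normr_le0.
    have := gL 0; rewrite normr0 mulr0; apply.
    by rewrite mulr_ge0 // (le_trans _ waD).
  have cst0 (F : R -> R) : (forall t : R, is_derive t 1 F 0) -> F (t0 + tau) - F t0 = 0.
    move=> dF; apply/eqP; rewrite -normr_le0 -(mul0r (t0 + tau - t0)).
    apply: (increment_norm_le (df := cst 0)) => //= t _.
      exact: is_derive1_continuous (dF t).
    by rewrite normr0.
  exists 0, Fa, Fb; split=> //.
  - split=> // rho c rho0 _ _; rewrite wa0 wb0 expr0n addr0 => r0.
    by have := exprn_gt0 2 rho0; rewrite ltNge r0.
  - rewrite wa0 !mulr0; apply: cst0 => t; have := dFa t.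
    by rewrite p0 g0 mulr0.
  - rewrite wb0 !mulr0; apply: cst0 => t; have := dFb t.
    by rewrite p0 g0 mulr0.
have {}w20 : 0 < w2 by rewrite lt0r w2n.
have tw : 0 < tau * w2 by rewrite mulr_gt0.
exists ((wa * A + wb * B) / (tau * w2)), Fa, Fb; split=> //.
- split.
  + rewrite divr_ge0 ?(ltW tw) //.
    have := JQ 0 0; rewrite !mul0r subrr; apply=> t.
    by rewrite mul0r subr0.
  + rewrite ler_pdivrMr // (le_trans JL) //.
    by have := mulr_ge0 L0 (ltW tw); lra.
  + move=> rho c rho0 cg c0 rw; rewrite ler_pdivlMr //.
    have : c * (tau * w2 / 2) - c * (rho ^+ 2 / 4) * tau <= wa * A + wb * B.
      by apply: JQ => t; have := cg _ (pD t); rewrite mulrBr.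
    have := ler_wpM2l (mulr_ge0 c0 (ltW tau0)) rw; rewrite -/w2; lra.
- rewrite -/A; apply: (mulIf w2n).
  have -> : A * w2 = (wa * A + wb * B) * wa.
    transitivity (wa * (wa * A) + wb * (wb * A)); first by rewrite /w2; ring.
    by rewrite -perp; ring.
  by field; rewrite w2n gt_eqF.
- rewrite -/B; apply: (mulIf w2n).
  have -> : B * w2 = (wa * A + wb * B) * wb.
    transitivity (wa * (wa * B) + wb * (wb * B)); first by rewrite /w2; ring.
    by rewrite perp; ring.
  by field; rewrite w2n gt_eqF.
Qed.

End Averaging.

(** * Uniform bounds on the couplings *)

Section Coupling.
Context {R : realType} {m : nat}.
Variable gamma : 'I_m -> 'I_m -> R -> R.
Hypothesis hgamma : interconnection gamma.
Hypothesis hlip : forall i j : 'I_m, i != j -> locally_lipschitz (gamma i j).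

Lemma common_lipschitz_constant (M : R) : 0 <= M ->
  exists2 L, 0 < L & forall i j, i != j -> forall y z, `|y| <= M -> `|z| <= M ->
    `|gamma i j y - gamma i j z| <= L * `|y - z|.
Proof.
move=> M0.
have Lij (p : 'I_m * 'I_m) : exists L : R, 0 < L /\ (p.1 != p.2 -> forall y z, `|y| <= M ->
    `|z| <= M -> `|gamma p.1 p.2 y - gamma p.1 p.2 z| <= L * `|y - z|).
  have [pe|pn] := eqVneq p.1 p.2; first by exists 1; split.
  by have [L L0 HL] := locally_lipschitz_segment M0 (hlip pn); exists L; split.
have [L HL] := choice Lij.
exists (1 + \sum_p L p).
  by rewrite ltr_pwDl // sumr_ge0 // => p _; have [/ltW] := HL p.
move=> i j ij y z yM zM; have [_ H] := HL (i, j).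
apply: (le_trans (H ij y z yM zM)); rewrite ler_wpM2r //.
rewrite (bigD1 (i, j)) //= addrCA lerDl addr_ge0 // sumr_ge0 // => p _.
by have [/ltW] := HL p.
Qed.

(** Below [rho / 2] the left-hand side is nonpositive. Above, [s * gamma s] is at
    least a positive constant given by the class K bound, while [s ^+ 2] is at most
    [D ^+ 2]. *)
Lemma edge_lower_bound i j (D rho : R) : edge gamma i j -> 0 < D -> 0 < rho ->
  exists2 c, 0 < c & forall c' s, 0 <= c' <= c -> `|s| <= D ->
    c' * (s ^+ 2 - rho ^+ 2 / 4) <= s * gamma i j s.
Proof.
move=> /andP[ij /asboolPn g0] D0 rho0.
have [_ gs [//|[alpha [_ alpha0 alpha_mono] ag]]] := hgamma ij.
have r0 : 0 < rho / 2 by rewrite divr_gt0.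
have a0 : 0 < alpha (rho / 2) by rewrite -alpha0; exact: alpha_mono.
have D20 : 0 < D ^+ 2 by rewrite exprn_gt0.
exists (rho / 2 * alpha (rho / 2) / D ^+ 2).
  by rewrite divr_gt0 // mulr_gt0.
move=> c' s /andP[c'0 c'c] sD; have s2 : s ^+ 2 = `|s| ^+ 2 by rewrite real_normK ?num_real.
have r2 : rho ^+ 2 / 4 = (rho / 2) ^+ 2 by field.
have [sr|rs] := leP `|s| (rho / 2).
  apply: le_trans (gs s); rewrite mulr_ge0_le0 // subr_le0 s2 r2.
  by rewrite lerXn2r // nnegrE // ltW.
have -> : s * gamma i j s = `|s| * `|gamma i j s| by rewrite -normrM ger0_norm.
apply: (@le_trans _ _ (rho / 2 * alpha (rho / 2))).
  move: c'c; rewrite ler_pdivlMr //; apply: le_trans.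
  rewrite ler_wpM2l // s2 lerBlDr (le_trans (_ : _ <= D ^+ 2)) ?lerDl //.
    by rewrite lerXn2r // nnegrE // ltW.
  by rewrite divr_ge0 // sqr_ge0.
apply: ler_pM; [exact: ltW|exact: ltW|exact: ltW|].
by apply: le_trans (ag s); apply: ltW; apply: alpha_mono => //; exact: ltW.
Qed.

Lemma coupling_rate (D L : R) : 0 < D -> 0 < L ->
  exists c : R -> R, forall rho, 0 < rho -> [/\ 0 < c rho, c rho <= L &
    forall i j s, edge gamma i j -> `|s| <= D ->
      4 * c rho * (s ^+ 2 - rho ^+ 2 / 4) <= s * gamma i j s].
Proof.
move=> D0 L0.
suff crho rho : exists c, 0 < rho -> [/\ 0 < c, c <= L &
    forall i j s, edge gamma i j -> `|s| <= D ->
      4 * c * (s ^+ 2 - rho ^+ 2 / 4) <= s * gamma i j s].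
  by have [c Hc] := choice crho; exists c.
have [rho0|] := ltP 0 rho; last by exists 0.
have cp (p : 'I_m * 'I_m) : exists c, 0 < c /\ (edge gamma p.1 p.2 ->
    forall c' s, 0 <= c' <= c -> `|s| <= D ->
    c' * (s ^+ 2 - rho ^+ 2 / 4) <= s * gamma p.1 p.2 s).
  have [ep|] := boolP (edge gamma p.1 p.2); last by exists 1; split.
  by have [c c0 Hc] := edge_lower_bound ep D0 rho0; exists c; split.
have [c Hc] := choice cp.
pose c0 := \big[Num.min/L]_p c p.
have c00 : 0 < c0 by apply: lt_bigmin => // p _; have [] := Hc p.
exists (c0 / 4) => _; split=> [| |i j s eij sD].
- by rewrite divr_gt0.
- have : c0 <= L by exact: bigmin_le_id.
  lra.
- have [_ H] := Hc (i, j); apply: (H eij) => //.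
  have -> : 4 * (c0 / 4) = c0 by field.
  by rewrite ltW //=; exact: bigmin_le.
Qed.

End Coupling.

(** * One period in the rotating frame *)

Definition coupling_input (R : realType) (m : nat) (gamma : 'I_m -> 'I_m -> R -> R)
    (omega : R) (a b : 'I_m -> R -> R) (i : 'I_m) (t : R) : R :=
  \sum_(j < m | j != i)
    gamma i j (projection omega (a j t - a i t) (b j t - b i t) t).

Definition rotating_solution (R : realType) (m : nat)
    (gamma : 'I_m -> 'I_m -> R -> R) (omega t0 s : R) (a b : 'I_m -> R -> R) : Prop :=
  [/\ forall i t, t0 <= t <= s -> {for t, continuous (a i)},
      forall i t, t0 <= t <= s -> {for t, continuous (b i)},
      forall i t, t0 < t < s -> is_derive t (1 : R) (a i)
        (- sin (omega * t) * coupling_input gamma omega a b i t) &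
      forall i t, t0 < t < s -> is_derive t (1 : R) (b i)
        (cos (omega * t) * coupling_input gamma omega a b i t)].

Section PeriodStep.
Context {R : realType} {m : nat}.
Variable gamma : 'I_m -> 'I_m -> R -> R.
Hypothesis hgamma : interconnection gamma.
Hypothesis hlip : forall i j : 'I_m, i != j -> locally_lipschitz (gamma i j).
Variables (D L : R) (c : R -> R).
Hypotheses (D0 : 0 < D) (L0 : 0 < L).
Hypothesis gammaL : forall i j, i != j -> forall y z, `|y| <= 2 * D -> `|z| <= 2 * D ->
    `|gamma i j y - gamma i j z| <= L * `|y - z|.
Hypothesis rate : forall rho, 0 < rho -> [/\ 0 < c rho, c rho <= L &
    forall i j s, edge gamma i j -> `|s| <= 2 * D ->
      4 * c rho * (s ^+ 2 - rho ^+ 2 / 4) <= s * gamma i j s].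
Variables (omega t0 s : R) (a b : 'I_m -> R -> R).
Hypothesis omega0 : 0 < omega.
Hypothesis sol : rotating_solution gamma omega t0 s a b.
Hypothesis aD : forall t, t0 <= t <= s -> spread_le (a^~ t) D.
Hypothesis bD : forall t, t0 <= t <= s -> spread_le (b^~ t) D.

(** A bound on the speed in the rotating frame when both spreads are at most [D]. *)
Definition input_bound : R := m%:R * (L * (2 * D)).
Let U := input_bound.
Let U0 : 0 <= U.
Proof. by rewrite !mulr_ge0 ?ler0n // ltW. Qed.

Lemma spread_le_norm (x : 'I_m -> R) S i j : spread_le x S -> `|x j - x i| <= S.
Proof.
by move=> xS; rewrite ler_norml lerNl opprB !xS.
Qed.

Lemma projection_spread i j t : t0 <= t <= s ->
  `|projection omega (a j t - a i t) (b j t - b i t) t| <= 2 * D.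
Proof.
move=> ts; apply: (le_trans (projection_norm_le _ _ _ _)).
have := spread_le_norm i j (aD ts); have := spread_le_norm i j (bD ts); lra.
Qed.

Lemma gamma_norm_le i j y : i != j -> `|y| <= 2 * D -> `|gamma i j y| <= L * `|y|.
Proof.
move=> ij yD; have [g0 _ _] := hgamma ij.
have := gammaL ij yD (_ : `|0| <= 2 * D); rewrite g0 !subr0; apply.
by rewrite normr0 mulr_ge0 // ltW.
Qed.

Lemma coupling_input_le i t : t0 <= t <= s -> `|coupling_input gamma omega a b i t| <= U.
Proof.
move=> ts; apply: (le_trans (ler_norm_sum _ _ _)).
have LD : 0 <= L * (2 * D) by rewrite !mulr_ge0 // ltW.
apply: sum_others_le => // j ji; rewrite eq_sym in ji.
apply: (le_trans (gamma_norm_le ji (projection_spread _ _ ts))).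
by rewrite ler_wpM2l ?(ltW L0) // projection_spread.
Qed.

Lemma norm_cosM_le (x y : R) : `|cos x * y| <= `|y|.
Proof. by rewrite normrM ler_piMl // ler_norml cos_geN1 cos_le1. Qed.

Lemma norm_sinM_le (x y : R) : `|- sin x * y| <= `|y|.
Proof. by rewrite normrM normrN ler_piMl // ler_norml sin_geN1 sin_le1. Qed.

Lemma rotating_drift i t t' : t0 <= t -> t <= t' -> t' <= s ->
  `|a i t' - a i t| <= U * (t' - t) /\ `|b i t' - b i t| <= U * (t' - t).
Proof.
move=> t0t tt' t's; have [ca cb da db] := sol.
split.
  apply: (@increment_norm_le _ _
    (fun t => - sin (omega * t) * coupling_input gamma omega a b i t)) => // x /andP[tx xt].
  - by apply: ca; lra.
  - by apply: da; lra.
  - by apply: (le_trans (norm_sinM_le _ _)); apply: coupling_input_le; lra.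
apply: (@increment_norm_le _ _
  (fun t => cos (omega * t) * coupling_input gamma omega a b i t)) => // x /andP[tx xt].
- by apply: cb; lra.
- by apply: db; lra.
- by apply: (le_trans (norm_cosM_le _ _)); apply: coupling_input_le; lra.
Qed.

Let tau := 2 * pi / omega.
(** During a period each projection moves by at most [4 * input_bound * tau]; the
    couplings turn this into a velocity error, integrated over a time [tau]. *)
Definition step_error (tau : R) : R := 4 * (m%:R * L) * input_bound * tau ^+ 2.

Lemma frozen_coupling i j t t' : i != j -> t0 <= t -> t <= t' <= t + tau -> t' <= s ->
  `|gamma i j (projection omega (a j t' - a i t') (b j t' - b i t') t')
    - gamma i j (projection omega (a j t - a i t) (b j t - b i t) t')|
  <= L * (4 * U * tau).
Proof.
move=> ij t0t /andP[tt' t'tau] t's; have ts : t0 <= t <= s by lra.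
have t's' : t0 <= t' <= s by lra.
apply: le_trans (gammaL ij _ _) _.
- exact: projection_spread.
- apply: (le_trans (projection_norm_le _ _ _ _)).
  have := spread_le_norm i j (aD ts); have := spread_le_norm i j (bD ts); lra.
rewrite ler_wpM2l ?(ltW L0) //.
have -> : projection omega (a j t' - a i t') (b j t' - b i t') t'
    - projection omega (a j t - a i t) (b j t - b i t) t'
  = projection omega ((a j t' - a j t) - (a i t' - a i t))
                     ((b j t' - b j t) - (b i t' - b i t)) t'.
  by rewrite /projection; ring.
apply: (le_trans (projection_norm_le _ _ _ _)).
have [aj bj] := rotating_drift j t0t tt' t's.
have [ai bi] := rotating_drift i t0t tt' t's.
have := ler_normB (a j t' - a j t) (a i t' - a i t).
have := ler_normB (b j t' - b j t) (b i t' - b i t).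
have tt : U * (t' - t) <= U * tau by rewrite ler_wpM2l //; lra.
lra.
Qed.

(** The difference between a coordinate and the sum of the frozen primitives of
    [averaged_coupling] has a derivative bounded by the unfreezing error. *)
Lemma period_step t : t0 <= t -> t + tau <= s ->
  consensus_step (edge gamma) c L tau (step_error tau) (a^~ t) (a^~ (t + tau)) /\
  consensus_step (edge gamma) c L tau (step_error tau) (b^~ t) (b^~ (t + tau)).
Proof.
move=> t0t ttau; have [ca cb da db] := sol.
have tau0 : 0 < tau by rewrite divr_gt0 // mulr_gt0 // pi_gt0.
have ts : t0 <= t <= s by lra.
pose wa i j := a j t - a i t; pose wb i j := b j t - b i t.
pose p i j := projection omega (wa i j) (wb i j).
have avg (ij : 'I_m * 'I_m) : exists kF : R * (R -> R) * (R -> R),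
    let: (kappa, Fa, Fb) := kF in let: (i, j) := ij in i != j ->
  [/\ [/\ 0 <= kappa, kappa <= L & edge gamma i j -> forall rho, 0 < rho ->
         rho ^+ 2 <= wa i j ^+ 2 + wb i j ^+ 2 -> c rho <= kappa],
      forall x, is_derive x (1 : R) Fa (- sin (omega * x) * gamma i j (p i j x)),
      forall x, is_derive x (1 : R) Fb (cos (omega * x) * gamma i j (p i j x)),
      Fa (t + tau) - Fa t = tau * (kappa * wa i j) &
      Fb (t + tau) - Fb t = tau * (kappa * wb i j)].
  case: ij => i j; have [ij|ij] := eqVneq i j; first by exists (0, cst 0, cst 0).
  have [_ gs _] := hgamma ij.
  have [kappa [Fa [Fb [[k0 kL kc] dFa dFb EFa EFb]]]] :=
    averaged_coupling (locally_lipschitz_continuous (hlip ij)) gs t omega0 (ltW L0)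
      (spread_le_norm i j (aD ts)) (spread_le_norm i j (bD ts))
      (fun y yD => gamma_norm_le ij yD).
  exists (kappa, Fa, Fb) => _; split=> //; split=> // eij rho rho0 rhow.
  have [c0 _ cr] := rate rho0.
  have := kc rho (4 * c rho) rho0 (fun y yD => cr i j y eij yD) _ rhow.
  have -> : 4 * c rho / 4 = c rho by field.
  by apply; rewrite mulr_ge0 // ltW.
have [kF HkF] := choice avg.
pose kappa i j := (kF (i, j)).1.1.
pose Fa i j := (kF (i, j)).1.2; pose Fb i j := (kF (i, j)).2.
have {}HkF i j : i != j ->
  [/\ [/\ 0 <= kappa i j, kappa i j <= L & edge gamma i j -> forall rho, 0 < rho ->
         rho ^+ 2 <= wa i j ^+ 2 + wb i j ^+ 2 -> c rho <= kappa i j],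
      forall x, is_derive x (1 : R) (Fa i j) (- sin (omega * x) * gamma i j (p i j x)),
      forall x, is_derive x (1 : R) (Fb i j) (cos (omega * x) * gamma i j (p i j x)),
      Fa i j (t + tau) - Fa i j t = tau * (kappa i j * wa i j) &
      Fb i j (t + tau) - Fb i j t = tau * (kappa i j * wb i j)].
  by have := HkF (i, j); rewrite /kappa /Fa /Fb; case: (kF (i, j)) => -[k1 F1] F2; apply.
have ttau' : t <= t + tau by rewrite lerDl ltW.
have EE : step_error tau = m%:R * (L * (4 * U * tau)) * (t + tau - t).
  by rewrite /step_error -/U; ring.
have err0 : 0 <= L * (4 * U * tau).
  by apply: mulr_ge0 (ltW L0) (mulr_ge0 (mulr_ge0 _ U0) (ltW tau0)).
have inputE i x : t < x < t + tau ->
  `|coupling_input gamma omega a b i x - \sum_(j < m | j != i) gamma i j (p i j x)|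
    <= m%:R * (L * (4 * U * tau)).
  move=> tx; rewrite /coupling_input -sumrB.
  apply: (le_trans (ler_norm_sum _ _ _)).
  by apply: sum_others_le => // j ji; apply: frozen_coupling => //;
    [rewrite eq_sym|lra|lra].
(* Both coordinates follow the same pattern, with the factor phi of the input. *)
have coordinate (x : 'I_m -> R -> R) (phi : R -> R) (F : 'I_m -> 'I_m -> R -> R) :
    (forall u y, `|phi u * y| <= `|y|) ->
    (forall i u, t0 <= u <= s -> {for u, continuous (x i)}) ->
    (forall i u, t0 < u < s ->
       is_derive u (1 : R) (x i) (phi u * coupling_input gamma omega a b i u)) ->
    (forall i j, (x j t - x i t) ^+ 2 <= wa i j ^+ 2 + wb i j ^+ 2) ->
    (forall i j, i != j -> forall u,
       is_derive u (1 : R) (F i j) (phi u * gamma i j (p i j u))) ->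
    (forall i j, i != j -> F i j (t + tau) - F i j t = tau * (kappa i j * (x j t - x i t))) ->
  consensus_step (edge gamma) c L tau (step_error tau) (x^~ t) (x^~ (t + tau)).
  move=> phi1 cx dx xw dF FE; exists kappa.
    move=> i j ij; have [[k0 kL kc] _ _ _ _] := HkF i j ij; split=> // eij rho rho0 rhox.
    apply: kc => //; apply: le_trans (xw i j).
    by rewrite -[leRHS]real_normK ?num_real // lerXn2r // nnegrE // ltW.
  move=> i; rewrite EE /consensus_increment mulr_sumr.
  under eq_bigr => j ji do rewrite -FE 1?eq_sym //.
  rewrite sumrB; pose G u := x i u - \sum_(j < m | j != i) F i j u.
  have -> : x i (t + tau) - x i t - (\sum_(j < m | j != i) F i j (t + tau)
     - \sum_(j < m | j != i) F i j t) = G (t + tau) - G t by rewrite /G; ring.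
  have dsum u : is_derive u (1 : R) (fun u => \sum_(j < m | j != i) F i j u)
      (\sum_(j < m | j != i) (phi u * gamma i j (p i j u))).
    by apply: is_derive_fct_sum => j ji; apply: dF; rewrite eq_sym.
  apply: (@increment_norm_le _ _ (fun u => phi u *
    (coupling_input gamma omega a b i u
     - \sum_(j < m | j != i) gamma i j (p i j u)))) => //.
  - move=> u tu; apply: continuousB; first by apply: cx; lra.
    exact: is_derive1_continuous (dsum u).
  - move=> u tu; have dxu := dx i u ltac:(lra).
    by apply: (is_derive_eq (is_derive_fctB dxu (dsum u))); rewrite mulrBr -mulr_sumr.
  - by move=> u tu; exact: (le_trans (phi1 _ _) (inputE i u tu)).
split.
  apply: (coordinate a (fun u => - sin (omega * u)) Fa) => //.
  - by move=> u y; exact: norm_sinM_le.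
  - by move=> i j; rewrite lerDl sqr_ge0.
  - by move=> i j ij; have [] := HkF i j ij.
  - by move=> i j ij; have [] := HkF i j ij.
apply: (coordinate b (fun u => cos (omega * u)) Fb) => //.
- by move=> u y; exact: norm_cosM_le.
- by move=> i j; rewrite lerDr sqr_ge0.
- by move=> i j ij; have [] := HkF i j ij.
- by move=> i j ij; have [] := HkF i j ij.
Qed.

End PeriodStep.

(** * Decay of the spread in the rotating frame *)

Section SampledSpread.
Context {R : realType} {m : nat}.
Variables (e : rel 'I_m) (c : R -> R) (L tau E U : R) (r : 'I_m) (n1 : nat).
Hypotheses (L0 : 0 < L) (tau0 : 0 < tau) (E0 : 0 <= E) (U0 : 0 <= U).
Hypothesis tauL : tau * (m%:R * L) <= 2^-1.
Hypothesis c_gt0 : forall rho, 0 < rho -> 0 < c rho.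
Hypothesis c_le : forall rho, 0 < rho -> c rho <= L.
Hypothesis er : forall i, i != r -> connect e i r.
Hypothesis ee : forall a b, e a b -> a != b.
Hypothesis n1tau : 4 * stage_scale (m := m) L <= n1%:R * tau.
Hypothesis n1L : (m * n1)%:R * (tau * (m%:R * L)) <= 2^-1.

(** The time [s] is reached from the last sample before it; within a period the
    drift is at most [U * tau]. *)
Lemma sampled_spread (x : 'I_m -> R -> R) (t0 s S d : R) (n : nat) : t0 <= s ->
    (forall t, t0 <= t -> t + tau <= s ->
       consensus_step e c L tau E (x^~ t) (x^~ (t + tau))) ->
    (forall i t t', t0 <= t -> t <= t' -> t' <= s ->
       `|x i t' - x i t| <= U * (t' - t)) ->
    spread_le (x^~ t0) S -> 0 < d -> d <= S ->
    (m * n1)%:R * E <= block_gain (m := m) c L d / 4 ->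
    (n * (m * n1))%:R * tau <= s - t0 ->
  spread_le (x^~ s) (Num.max d (S - n%:R * (block_gain (m := m) c L d / 2))
    + block_gain (m := m) c L d / 2 + 2 * (U * tau)).
Proof.
move=> t0s step drift xS d0 dS NE nN.
have q0 : 0 <= (s - t0) / tau by rewrite divr_ge0 ?subr_ge0 // ltW.
set k := Num.truncn ((s - t0) / tau).
have /andP[kq qk] := truncn_itv q0; rewrite -/k in kq qk.
rewrite ler_pdivlMr // in kq; rewrite ltr_pdivrMr // -natr1 in qk.
pose y l : 'I_m -> R := x^~ (t0 + l%:R * tau).
have ystep l : (l < k)%N -> consensus_step e c L tau E (y l) (y l.+1).
  move=> lk; rewrite /y -(natr1 l) mulrDl mul1r addrA; apply: step.
    by rewrite lerDl mulr_ge0 // ltW.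
  have : (l.+1)%:R * tau <= k%:R * tau by rewrite ler_wpM2r ?ler_nat // ltW.
  by rewrite -(natr1 l); lra.
have y0S : spread_le (y 0%N) S by move=> i j; rewrite /y mul0r addr0.
have nk : (n * (m * n1) <= k <= k)%N.
  by rewrite leqnn andbT truncn_ge_nat // ler_pdivlMr.
have ys := spread_consensus L0 (ltW tau0) E0 tauL c_gt0 c_le er ee n1tau n1L
  ystep y0S d0 dS NE nk.
move=> i j; have := ys i j; rewrite /y.
have drk i' : `|x i' s - x i' (t0 + k%:R * tau)| <= U * tau.
  apply: (le_trans (drift _ _ _ _ _ _)); [|lra|exact: lexx|].
    by rewrite lerDl mulr_ge0 // ltW.
  by rewrite ler_wpM2l //; lra.
have := drk i; have := drk j; rewrite !ler_norml => /andP[j1 j2] /andP[i1 i2].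
lra.
Qed.

End SampledSpread.

Section RotatingSpread.
Context {R : realType} {m : nat}.
Variable gamma : 'I_m -> 'I_m -> R -> R.
Hypothesis hgamma : interconnection gamma.
Hypothesis hconn : connected_interconnection gamma.
Hypothesis hlip : forall i j : 'I_m, i != j -> locally_lipschitz (gamma i j).

(** All constants, in particular [block_gain], are fixed by [B] and [d] before the
    period is chosen; then [tau] is taken so small that the errors over a block and
    the drift within a period are negligible against [block_gain]. *)
Theorem rotating_spread (B d : R) : 0 < d -> d <= B ->
  exists2 omega_star, 0 < omega_star & forall omega, omega_star <= omega ->
  exists2 T, 0 < T & forall (t0 s : R) (a b : 'I_m -> R -> R), t0 <= s ->
    rotating_solution gamma omega t0 s a b ->
    (forall t, t0 <= t <= s -> spread_le (a^~ t) (B + 2 * d)) ->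
    (forall t, t0 <= t <= s -> spread_le (b^~ t) (B + 2 * d)) ->
    forall S, d <= S -> S <= B -> spread_le (a^~ t0) S -> spread_le (b^~ t0) S ->
    (spread_le (a^~ s) (S + d) /\ spread_le (b^~ s) (S + d)) /\
    (t0 + T <= s -> spread_le (a^~ s) (2 * d) /\ spread_le (b^~ s) (2 * d)).
Proof.
move=> d0 dB; have [r er] := hconn.
set D := B + 2 * d; have D0 : 0 < D by rewrite /D; lra.
have D20 : 0 < 2 * D by lra.
have m0 : (0 < m)%N by exact: leq_ltn_trans (ltn_ord r).
have m0' : 0 < m%:R :> R by rewrite ltr0n.
have m1 : 1 <= m%:R :> R by rewrite ler1n.
have [L L0 gL] := common_lipschitz_constant hlip (ltW D20).
have [c Hc] := coupling_rate hgamma D20 L0.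
have c0 rho : 0 < rho -> 0 < c rho by move=> /Hc[].
have cL rho : 0 < rho -> c rho <= L by move=> /Hc[].
have ee i j : edge gamma i j -> i != j by move=> /andP[].
set g := block_gain (m := m) c L d; set P := stage_scale (m := m) L.
have P0 : 0 < P := stage_scale_gt0 L0 m0.
have g0 : 0 < g := block_gain_gt0 L0 c0 r d0.
have gd : g <= d / 4.
  have d40 : 0 < d / 4 by lra.
  exact: (iter_next_level_le (a := 0) L0 c0 cL m0 d40 (leq0n m)).
set U := input_bound (m := m) D L.
have U0 : 0 < U by rewrite !mulr_gt0.
(* The first bound limits the loss and the rounding over a block, the second the
   accumulated errors and the drift within a period. *)
pose tau_star := Num.min (4 * P) (g / (8 * U)).
have ts0 : 0 < tau_star by rewrite lt_min mulr_gt0 // divr_gt0 // mulr_gt0.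
have pi0 : 0 < 2 * pi :> R by rewrite mulr_gt0 // pi_gt0.
exists (2 * pi / tau_star); first by rewrite divr_gt0.
move=> omega oo; have o0 : 0 < omega by apply: lt_le_trans oo; rewrite divr_gt0.
set tau := 2 * pi / omega; have tau0 : 0 < tau by rewrite divr_gt0.
have : tau <= tau_star.
  by move: oo; rewrite /tau !ler_pdivrMr // [omega * _]mulrC.
rewrite le_min => /andP[tauP]; rewrite ler_pdivlMr ?mulr_gt0 // => tauU.
have PE : m%:R ^+ 2 * L * P = 16^-1.
  by rewrite /P /stage_scale; field; rewrite !gt_eqF.
set n1 := (Num.truncn (4 * P / tau)).+1.
have P40 : 0 <= 4 * P by rewrite mulr_ge0 // ltW.
have q0 : 0 <= 4 * P / tau by rewrite divr_ge0 // ltW.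
have /andP[n1a n1b] := truncn_itv q0; rewrite -/n1 in n1b.
rewrite ler_pdivlMr // in n1a; rewrite ltr_pdivrMr // in n1b.
have n1c : n1%:R * tau <= 8 * P by rewrite /n1 -natr1; lra.
have tauL : tau * (m%:R * L) <= 2^-1.
  have mL : 0 <= m%:R * L by rewrite mulr_ge0 // ltW.
  have := ler_wpM2r mL tauP.
  have m2 : m%:R * L * P <= m%:R ^+ 2 * L * P.
    apply: ler_wpM2r; first exact: ltW.
    apply: ler_wpM2r; first exact: ltW.
    by rewrite expr2 ler_peMl // ltW.
  lra.
have mn : (m * n1)%:R = m%:R * n1%:R :> R by rewrite natrM.
have n1L : (m * n1)%:R * (tau * (m%:R * L)) <= 2^-1.
  have m2L : 0 <= m%:R ^+ 2 * L by rewrite mulr_ge0 ?sqr_ge0 // ltW.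
  by rewrite mn; have := ler_wpM2l m2L n1c; lra.
have E0 : 0 <= step_error (m := m) D L tau.
  apply: mulr_ge0 (sqr_ge0 _); apply: mulr_ge0 (ltW U0).
  by rewrite !mulr_ge0 // ltW.
have NE : (m * n1)%:R * step_error (m := m) D L tau <= g / 4.
  rewrite mn /step_error -/U.
  have z : 0 <= 4 * (m%:R ^+ 2 * L) * (U * tau).
    apply: mulr_ge0 (mulr_ge0 (ltW U0) (ltW tau0)).
    by rewrite mulr_ge0 // mulr_ge0 ?sqr_ge0 // ltW.
  have := ler_wpM2l z n1c.
  have -> : 4 * (m%:R ^+ 2 * L) * (U * tau) * (8 * P) =
     32 * (m%:R ^+ 2 * L * P) * (U * tau) by ring.
  rewrite PE; lra.
(* Each block gains at least g / 2, so n blocks exhaust B. *)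
pose n := (Num.truncn (2 * B / g)).+1.
exists ((n * (m * n1))%:R * tau).
  by rewrite mulr_gt0 // ltr0n !muln_gt0 m0.
move=> t0 s a b t0s sol aD bD S dS SB aS bS.
have stp t (t0t : t0 <= t) (ts : t + tau <= s) :=
  period_step hgamma hlip D0 L0 gL Hc o0 sol aD bD t0t ts.
have drift := rotating_drift hgamma D0 L0 gL sol aD bD.
have sampled (x : 'I_m -> R -> R) n' : 
    (forall t, t0 <= t -> t + tau <= s -> consensus_step (edge gamma) c L tau
       (step_error (m := m) D L tau) (x^~ t) (x^~ (t + tau))) ->
    (forall i t t', t0 <= t -> t <= t' -> t' <= s ->
       `|x i t' - x i t| <= U * (t' - t)) ->
    spread_le (x^~ t0) S -> (n' * (m * n1))%:R * tau <= s - t0 ->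
    spread_le (x^~ s) (Num.max d (S - n'%:R * (g / 2)) + d).
  move=> xstep xdrift xS n's i j.
  apply: le_trans (sampled_spread L0 tau0 E0 (ltW U0) tauL c0 cL er ee (ltW n1b) n1L
    t0s xstep xdrift xS d0 dS NE n's i j) _.
  by rewrite -/g -addrA lerD2l; lra.
have astep t t0t ts := (stp t t0t ts).1; have bstep t t0t ts := (stp t t0t ts).2.
have adrift i t t' h1 h2 h3 := (drift i t t' h1 h2 h3).1.
have bdrift i t t' h1 h2 h3 := (drift i t t' h1 h2 h3).2.
split.
  have n00 : (0 * (m * n1))%:R * tau <= s - t0 by rewrite mul0n mul0r subr_ge0.
  have := sampled a 0%N astep adrift aS n00.
  have := sampled b 0%N bstep bdrift bS n00.
  by rewrite mul0r subr0 max_r.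
move=> Ts; have nTs : (n * (m * n1))%:R * tau <= s - t0 by lra.
have -> : 2 * d = Num.max d (S - n%:R * (g / 2)) + d.
  rewrite max_l; first by ring.
  have Bg0 : 0 <= 2 * B / g by rewrite divr_ge0 ?(ltW g0) //; lra.
  have /andP[_] := truncn_itv Bg0; rewrite -/n ltr_pdivrMr //; lra.
by split; apply: sampled.
Qed.

End RotatingSpread.

(** * Vector-valued calculus *)

Lemma cvg_halves (R : realType) (C : R) : (fun k => C / 2 ^+ k) @ \oo --> (0 : R).
Proof.
have := @cvg_geometric R C 2^-1; rewrite /geometric /=.
under eq_fun do rewrite exprVn.
by apply; rewrite ger0_norm ?invr_ge0 // invf_lt1 // ltr1n.
Qed.

Section VectorCalculus.
Context {R : realType} {n : nat}.
Implicit Types (x y : R -> 'rV[R]_n) (u v : 'rV[R]_n).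

Lemma rV_norm_le u (k : R) : 0 <= k -> (forall j, `|u ord0 j| <= k) -> `|u| <= k.
Proof.
move=> k0 uk; rewrite /Num.Def.normr /= mx_normrE.
by apply: bigmax_le => //= -[i j] _ /=; rewrite ord1.
Qed.

Lemma rV_coord_le u j : `|u ord0 j| <= `|u|.
Proof.
by rewrite [leRHS]/Num.Def.normr /= mx_normrE; exact: (le_bigmax _ _ (ord0, j)).
Qed.

Lemma is_derive_rV_coord x (t : R) v j : is_derive t (1 : R) x v ->
  is_derive t (1 : R) (fun t => x t ord0 j) (v ord0 j).
Proof.
move=> [dx <-]; apply: DeriveDef; first by have /derivable_mxP := dx; apply.
by rewrite derive_mx // mxE.
Qed.

Lemma is_derive_rV x (t : R) v :
    (forall j, is_derive t (1 : R) (fun t => x t ord0 j) (v ord0 j)) ->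
  is_derive t (1 : R) x v.
Proof.
move=> dx; have xd : derivable x t 1.
  by apply/derivable_mxP => i j; rewrite ord1; have [] := dx j.
apply: DeriveDef => //; rewrite derive_mx //; apply/rowP => j; rewrite mxE.
by have [_ ->] := dx j.
Qed.

Lemma is_derive_rV_continuous x (t : R) v : is_derive t (1 : R) x v ->
  {for t, continuous x}.
Proof. by move=> [xd _]; apply: differentiable_continuous; exact/derivable1_diffP. Qed.

Lemma rV_increment_le x (dx : R -> 'rV[R]_n) (a b k : R) : a <= b -> 0 <= k ->
    (forall t, a <= t <= b -> {for t, continuous x}) ->
    (forall t, a < t < b -> is_derive t (1 : R) x (dx t)) ->
    (forall t, a < t < b -> `|dx t| <= k) ->
  `|x b - x a| <= k * (b - a).
Proof.
move=> ab k0 cx dxx dxk; apply: rV_norm_le; first by rewrite mulr_ge0 // subr_ge0.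
move=> j; rewrite !mxE; apply: (increment_norm_le (f := fun t => x t ord0 j)
  (df := fun t => dx t ord0 j)) => // t tab.
- apply: (@continuous_comp _ _ _ x (fun u : 'rV_n => u ord0 j)); first exact: cx.
  exact: coord_continuous.
- exact: is_derive_rV_coord (dxx t tab).
- exact: le_trans (rV_coord_le _ _) (dxk t tab).
Qed.

Lemma rV_primitive x : continuous x ->
  exists X : R -> 'rV[R]_n, forall t, is_derive t (1 : R) X (x t).
Proof.
move=> cx; have primj j : exists G : R -> R, forall t, is_derive t (1 : R) G (x t ord0 j).
  apply: (@continuous_primitive R (fun t => x t ord0 j)) => t.
  apply: (@continuous_comp _ _ _ x (fun u : 'rV_n => u ord0 j)); first exact: cx.
  exact: coord_continuous.
have [G dG] := choice primj.
exists (fun t => \row_j G j t) => t; apply: is_derive_rV => j.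
by under eq_fun do rewrite mxE; exact: dG.
Qed.

(** The rate is kept because the iterates below have to converge uniformly in time. *)
Lemma geometric_cauchy_limit (w : nat -> 'rV[R]_n) (C : R) :
    (forall k, `|w k.+1 - w k| <= C / 2 ^+ k) ->
  exists l, forall k, `|l - w k| <= 2 * C / 2 ^+ k.
Proof.
move=> wC; have C0 : 0 <= C.
  by have := wC 0%N; rewrite expr0 divr1; exact: le_trans.
have tail k p : `|w (k + p)%N - w k| <= 2 * C / 2 ^+ k - 2 * C / 2 ^+ (k + p).
  elim: p => [|p IH]; first by rewrite addn0 !subrr normr0.
  have -> : w (k + p.+1)%N - w k = (w (k + p).+1 - w (k + p)%N) + (w (k + p)%N - w k).
    by rewrite addnS addrA subrK.
  apply: (le_trans (ler_normD _ _)); have := wC (k + p)%N.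
  have -> : 2 * C / 2 ^+ (k + p.+1) = C / 2 ^+ (k + p).
    by rewrite addnS exprS; field; rewrite expf_neq0.
  lra.
have tail' k p : (k <= p)%N -> `|w p - w k| <= 2 * C / 2 ^+ k.
  move=> /subnKC <-; apply: (le_trans (tail _ _)); rewrite gerBl.
  by rewrite divr_ge0 ?exprn_ge0 // mulr_ge0.
have /cvg_ex[l wl] : cvg (w @ \oo).
  apply/cauchy_cvgP/cauchy_exP => e e0.
  have [k _ /(_ k (leqnn k))] : \forall k \near \oo, `|2 * C / 2 ^+ k| < e.
    by have /cvgr0Pnorm_lt := cvg_halves (2 * C); apply.
  move=> ke; exists (w k); exists k => // p /= kp.
  rewrite -ball_normE /= distrC (le_lt_trans (tail' _ _ kp)) //.
  exact: le_lt_trans (ler_norm _) ke.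
exists l => k; apply/ler_addgt0Pr => e e0.
have [q _ /(_ (maxn q k) (leq_maxl _ _))] : \forall p \near \oo, `|l - w p| < e.
  by move/cvgrPdist_lt: wl => /(_ _ e0).
move=> lq; rewrite -(subrK (w (maxn q k)) l) -addrA (le_trans (ler_normD _ _)) //.
rewrite [leLHS]addrC; apply: lerD (ltW lq); apply: tail'; exact: leq_maxr.
Qed.

End VectorCalculus.

Section Clip.
Context {R : realType}.
(** Truncation to [a, b], used both to extend functions of time constantly beyond a
    window and to saturate the couplings. *)
Definition clip (a b t : R) : R := Num.max a (Num.min t b).

Lemma clip_itv a b t : a <= b -> a <= clip a b t <= b.
Proof. by move=> ab; rewrite /clip le_max lexx ge_max ab ge_min lexx orbT. Qed.

Lemma clip_id a b t : a <= t <= b -> clip a b t = t.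
Proof. by move=> /andP[at_ tb]; rewrite /clip min_l // max_r. Qed.

Lemma clip_dist a b s t : `|clip a b s - clip a b t| <= `|s - t|.
Proof.
wlog st : s t / s <= t.
  move=> H; case/orP: (le_total s t) => st; first exact: H.
  by rewrite distrC (distrC s); exact: H.
have st0 : s - t <= 0 by rewrite subr_le0.
rewrite (ler0_norm st0) /clip ler_norml.
have minb (x : R) : Num.min x b = x /\ x <= b \/ Num.min x b = b /\ b < x.
  by have [xb|bx] := leP x b; [left|right].
have maxa (x : R) : Num.max a x = x /\ a <= x \/ Num.max a x = a /\ x < a.
  by have [ax|xa] := leP a x; [left|right].
by case: (minb s) => -[-> ?]; case: (minb t) => -[-> ?];
  case: (maxa s) => -[? ?]; case: (maxa t) => -[? ?];
  case: (maxa b) => -[? ?]; lra.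
Qed.

Lemma clip_continuous a b : continuous (clip a b).
Proof.
move=> t; apply/cvgrPdist_le => /= e e0; near=> s.
apply: le_trans (clip_dist _ _ _ _) _.
by near: s; exact: cvgr_dist_le.
Unshelve. all: by end_near. Qed.
End Clip.

(** * Local existence *)

Section Picard.
Context {R : realType} {n : nat}.
Variables (F : 'rV[R]_n -> 'rV[R]_n) (K : R).
Hypothesis K0 : 0 < K.
Hypothesis FK : forall x y, `|F x - F y| <= K * `|x - y|.

Lemma lipschitz_field_continuous (y : R -> 'rV[R]_n) (t : R) :
  {for t, continuous y} -> {for t, continuous (fun t => F (y t))}.
Proof.
move=> cy; apply/cvgrPdist_le => /= e e0; near=> u.
apply: le_trans (FK _ _) _; rewrite mulrC -ler_pdivlMr //.
by near: u; apply: cvgr_dist_le => //; rewrite divr_gt0.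
Unshelve. all: by end_near. Qed.

(** On the window of radius [1 / (2 K)] the integral operator halves distances. Time
    is clipped to the window, so that the iterates are functions on the whole line
    and converge uniformly. *)
Theorem picard (s : R) (x0 : 'rV[R]_n) : exists2 y : R -> 'rV[R]_n, y s = x0 &
  forall t, `|t - s| < (2 * K)^-1 -> is_derive t (1 : R) y (F (y t)).
Proof.
set h := (2 * K)^-1; have h0 : 0 < h by rewrite invr_gt0 mulr_gt0.
have Kh : K * h = 2^-1 by rewrite /h; field; rewrite gt_eqF.
pose cl := clip (s - h) (s + h).
have cl_itv t : s - h <= cl t <= s + h by apply: clip_itv; lra.
have cls : cl s = s by apply: clip_id; lra.
have prim (y : R -> 'rV[R]_n) : exists G : R -> 'rV[R]_n, continuous y ->
    forall t, is_derive t (1 : R) G (F (y t)).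
  have [cy|] := pselect (continuous y); last by exists (cst 0).
  have [G dG] := rV_primitive (fun t => lipschitz_field_continuous (cy t)).
  by exists G.
have [G dG] := choice prim.
pose T y t := x0 + (G y (cl t) - G y s).
have Tc y : continuous y -> continuous (T y).
  move=> cy t; apply: cvgD; first exact: cvg_cst.
  apply: cvgB; last exact: cvg_cst.
  apply: (@continuous_comp _ _ _ cl (G y)); first exact: clip_continuous.
  exact: is_derive_rV_continuous (dG y cy _).
(* A bound k on the speed of D moves it by at most k h within the window. *)
have window (D : R -> 'rV[R]_n) dD k : 0 <= k ->
    (forall t, is_derive t (1 : R) D (dD t)) -> (forall t, `|dD t| <= k) ->
    forall t, `|D (cl t) - D s| <= k * h.
  move=> k0 dDD dDk t; have /andP[t1 t2] := cl_itv t.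
  have cD u : {for u, continuous D} by exact: is_derive_rV_continuous (dDD u).
  have [st|ts] := leP s (cl t).
    apply: (le_trans (rV_increment_le st k0 _ _ _)) => //.
    by rewrite ler_wpM2l //; lra.
  rewrite distrC.
  apply: (le_trans (rV_increment_le (ltW ts) k0 _ _ _)) => //.
  by rewrite ler_wpM2l //; lra.
have contract y z M : continuous y -> continuous z -> (forall t, `|y t - z t| <= M) ->
    forall t, `|T y t - T z t| <= M / 2.
  move=> cy cz yzM t; have M0 : 0 <= M := le_trans (normr_ge0 _) (yzM s).
  have -> : T y t - T z t = (G y (cl t) - G z (cl t)) - (G y s - G z s).
    by rewrite /T (addrC x0) addrKA !opprB addrACA [in RHS]addrACA [- G y s + _]addrC.
  have -> : M / 2 = K * M * h by rewrite mulrAC Kh mulrC.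
  apply: (window (fun u => G y u - G z u) (fun u => F (y u) - F (z u))).
  - by rewrite mulr_ge0 // ltW.
  - by move=> u; have dy := dG y cy u; have dz := dG z cz u; exact: is_deriveB.
  - by move=> u; apply: le_trans (FK _ _) _; rewrite ler_wpM2l // ltW.
pose w k := iter k T (cst x0).
have wc k : continuous (w k).
  by elim: k => [|k IH]; [exact: cst_continuous|exact: Tc].
pose C := `|F x0| * h.
have wC k t : `|w k.+1 t - w k t| <= C / 2 ^+ k.
  elim: k t => [|k IH] t.
    rewrite expr0 divr1 /w /= /T /cst addrAC subrr add0r.
    apply: (window _ (fun=> F x0)) => // u.
    exact: (dG (cst x0) (@cst_continuous _ _ x0)).
  rewrite exprSr invfM mulrA.
  exact: (contract (w k.+1) (w k) (C / 2 ^+ k) (wc k.+1) (wc k) IH t).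
have [y yw] := choice (fun t => geometric_cauchy_limit (fun k => wC k t)).
have geo e : 0 < e -> exists k, 2 * C / 2 ^+ k < e.
  move=> e0; have := cvg_halves (2 * C).
  move/cvgr0Pnorm_lt => /(_ _ e0)[k _ /(_ k (leqnn k))] ke.
  by exists k; exact: le_lt_trans (ler_norm _) ke.
have yc : continuous y.
  move=> t; apply/cvgrPdist_le => /= e e0.
  have [k ke] : exists k, 2 * C / 2 ^+ k < e / 3 by apply: geo; rewrite divr_gt0.
  near=> u; have : `|w k t - w k u| <= e / 3.
    by near: u; apply: cvgr_dist_le; [exact: wc|rewrite divr_gt0].
  have yt := yw t k; have := yw u k; rewrite distrC => yu wtu.
  have -> : y t - y u = (y t - w k t) + ((w k t - w k u) + (w k u - y u)).
    by rewrite !subrKA.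
  apply: (le_trans (ler_normD _ _)).
  have := ler_normD (w k t - w k u) (w k u - y u); lra.
have yT t : y t = T y t.
  apply/eqP; rewrite -subr_eq0 -normr_le0; apply/ler_addgt0Pr => e e0.
  have [k ke] : exists k, 2 * C / 2 ^+ k < e / 2 by apply: geo; rewrite divr_gt0.
  have -> : y t - T y t = (y t - w k.+1 t) + (w k.+1 t - T y t) by rewrite subrKA.
  apply: (le_trans (ler_normD _ _)).
  have yk := yw t k.+1.
  have : `|w k.+1 t - T y t| <= 2 * C / 2 ^+ k / 2.
    rewrite distrC; exact: contract yc (wc k) (fun u => yw u k) t.
  have C0 : 0 <= 2 * C / 2 ^+ k.
    by apply: le_trans (yw t k).
  move: yk; rewrite exprSr invfM mulrA; lra.
exists y; first by rewrite yT /T cls subrr addr0.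
move=> t ts; have yG : \forall u \near t, x0 + (G y u - G y s) = y u.
  near=> u; rewrite [RHS]yT /T /cl clip_id //.
  have : `|u - s| <= h.
    apply: ltW; near: u; apply: cvgr_norm_lt ts.
    by apply: cvgB; [exact: cvg_id|exact: cvg_cst].
  by rewrite ler_norml; lra.
apply: near_eq_is_derive yG _.
have dGt := dG y yc t.
have -> : F (y t) = 0 + (F (y t) - 0) by rewrite subr0 add0r.
apply: is_deriveD; apply: is_deriveB.
Unshelve. all: by end_near. Qed.

End Picard.

(** * Continuation of solutions *)

Section Continuation.
Context {R : realType} {n : nat}.
Implicit Types (x : R -> 'rV[R]_n) (b : \bar R).

Lemma near_lt_ereal (t : R) b : (t%:E < b)%E -> \forall u \near t, (u%:E < b)%E.
Proof.
case: b => [r| |] //= => [tr|_]; last by near=> u; rewrite ltry.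
by near=> u; rewrite lte_fin; near: u; apply: lt_nbhsl; rewrite -lte_fin.
Unshelve. all: by end_near. Qed.

(** Only the values on the time interval of the solution matter; freezing the state
    before the initial time replaces one-sided continuity there by continuity. *)
Lemma solution_frozen_before (f : 'rV[R]_n -> R -> 'rV[R]_n) (t0 : R) b x :
    solution f t0 b x -> let x' := fun t => x (Num.max t0 t) in
  (forall t : R, (t%:E < b)%E -> {for t, continuous x'}) /\
  (forall t : R, t0 < t -> (t%:E < b)%E -> is_derive t (1 : R) x' (f (x' t) t)).
Proof.
move=> [t0b cx dx] x'; split; last first.
  move=> t t0t tb; have dxt := dx t t0t tb; have -> : x' t = x t.
    by rewrite /x' max_r // ltW.
  apply: near_eq_is_derive dxt; near=> u; rewrite /x' max_r //.
  by apply: ltW; near: u; exact: lt_nbhsr.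
move=> t tb; have TI u : (u%:E < b)%E -> time_interval t0 b (Num.max t0 u).
  by move=> ub; split; [rewrite le_max lexx|rewrite maxEle; case: ifP].
have /subspace_continuousP/(_ _ (TI t tb)) cxm := cx.
have cmax : {for t, continuous (fun u => Num.max t0 u)}.
  apply/cvgrPdist_le => /= e e0; near=> u.
  apply: (@le_trans _ _ `|t - u|); last by near: u; exact: cvgr_dist_le.
  have maxt0 (v : R) : Num.max t0 v = v /\ t0 <= v \/ Num.max t0 v = t0 /\ v < t0.
    by have [?|?] := leP t0 v; [left|right].
  have := ler_norm (t - u); have := ler_norm (- (t - u)); rewrite normrN ler_norml.
  by case: (maxt0 t) => -[? ?]; case: (maxt0 u) => -[? ?]; lra.
apply/cvgrPdist_le => /= e e0.
move/cvgrPdist_le : cxm => /(_ e e0) cxm.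
have xe : \forall u \near t, time_interval t0 b (Num.max t0 u) ->
    `|x (Num.max t0 t) - x (Num.max t0 u)| <= e by exact: cmax _ cxm.
have ub := near_lt_ereal tb; near=> u.
have ltub : (u%:E < b)%E by near: u.
have xu : time_interval t0 b (Num.max t0 u) ->
    `|x (Num.max t0 t) - x (Num.max t0 u)| <= e by near: u.
exact: xu (TI _ ltub).
Unshelve. all: by end_near. Qed.

(** At its maximum the function is at most half of itself. *)
Lemma segment_zero_of_contraction (g : R -> R) (s c : R) : s <= c ->
    (forall t, s <= t <= c -> {for t, continuous g}) -> (forall t, 0 <= g t) ->
    (forall M t, s <= t <= c -> (forall u, s <= u <= c -> g u <= M) -> g t <= M / 2) ->
  forall t, s <= t <= c -> g t = 0.
Proof.
move=> sc cg g0 half t tsc.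
have [|d /[!in_itv]/= dsc gd] := @EVT_max R g s c sc.
  by apply: continuous_in_subspaceT => u /[!inE]/=; rewrite in_itv; exact: cg.
have {}gd u : s <= u <= c -> g u <= g d by move=> usc; apply: gd; rewrite in_itv.
have := half _ d dsc gd; have := gd t tsc; have := g0 t; have := g0 d.
by move=> *; apply/eqP; rewrite eq_le; apply/andP; split; lra.
Qed.

(** A Picard solution of the Lipschitz field [F'] is started at a time close to
    [beta], within the existence window. It agrees with [x] up to [beta] by local
    uniqueness, and since it is continuous at [beta] it stays within [eps] of an
    earlier value of [x] for a while after [beta], so that it also solves the
    equation for [F]. *)
Theorem solution_extends (F F' : 'rV[R]_n -> 'rV[R]_n) (K eps t0 beta : R) x :
    0 < K -> (forall y z, `|F' y - F' z| <= K * `|y - z|) -> 0 < eps ->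
    solution (fun y _ => F y) t0 beta%:E x ->
    (forall t z, t0 <= t < beta -> `|z - x t| < eps -> F z = F' z) ->
  exists b y, [/\ (beta%:E < b)%E, solution (fun y _ => F y) t0 b y &
     forall t, time_interval t0 beta%:E t -> y t = x t].
Proof.
move=> K0 F'K eps0 [t0b cx dx] FF'; rewrite lte_fin in t0b.
have FF'x t : t0 <= t < beta -> F (x t) = F' (x t).
  by move=> tb; apply: (FF' t) => //; rewrite subrr normr0.
set h := (2 * K)^-1; have h0 : 0 < h by rewrite invr_gt0 mulr_gt0.
have Kh : K * h = 2^-1 by rewrite /h; field; rewrite gt_eqF.
(* A restart time in the open interval, so close to beta that the window of the
   local solution contains beta. *)
have [s [t0s sb bs]] : exists s, [/\ t0 < s, s < beta & beta - s < h].
  exists (Num.max ((t0 + beta) / 2) (beta - h / 2)); split.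
  - by rewrite lt_max; apply/orP; left; lra.
  - by rewrite gt_max; apply/andP; split; lra.
  - have : beta - h / 2 <= Num.max ((t0 + beta) / 2) (beta - h / 2).
      by rewrite le_max lexx orbT.
    lra.
have [y ys] := picard K0 F'K s (x s); rewrite -/h => dy.
have xy t : s <= t -> t < beta -> y t = x t.
  move=> st tb; apply/eqP; rewrite -subr_eq0 -normr_eq0; apply/eqP.
  have dxy u : s <= u <= t ->
      is_derive u (1 : R) (fun u => y u - x u) (F' (y u) - F' (x u)).
    move=> ut; rewrite -(FF'x u); last by lra.
    have dyu : is_derive u (1 : R) y (F' (y u)).
      by apply: dy; rewrite ltr_norml; lra.
    have dxu : is_derive u (1 : R) x (F (x u)) by apply: dx; rewrite ?lte_fin; lra.
    exact: is_deriveB.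
  apply: (@segment_zero_of_contraction (fun u => `|y u - x u|) s t) => //.
  - move=> u ut; apply: cvg_norm; exact: is_derive_rV_continuous (dxy u ut).
  - move=> M u /andP[su ut] yxM.
    have M0 : 0 <= M by apply: le_trans (yxM s _) => //; rewrite lexx.
    have KM0 : 0 <= K * M by rewrite mulr_ge0 // ltW.
    have := @rV_increment_le _ _ (fun u => y u - x u) (fun u => F' (y u) - F' (x u))
      s u (K * M) su KM0.
    rewrite ys subrr subr0 => H.
    apply: (@le_trans _ _ (K * M * (u - s))).
      apply: H => v /andP[sv vu].
      + by apply: (is_derive_rV_continuous (dxy v _)); lra.
      + by apply: dxy; lra.
      + apply: (le_trans (F'K _ _)); rewrite ler_wpM2l ?(ltW K0) //.
        by apply: yxM; lra.
    have : K * M * (u - s) <= K * M * h by rewrite ler_wpM2l //; lra.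
    have -> : K * M * h = M / 2 by rewrite mulrAC Kh mulrC.
    by [].
  - by rewrite st lexx.
have cyb : {for beta, continuous y}.
  by apply: (is_derive_rV_continuous (dy beta _)); rewrite ltr_norml; lra.
have [delta delta0 ydelta] : exists2 delta : R, 0 < delta &
    forall u, `|beta - u| < delta -> `|y beta - y u| < eps / 2.
  move/cvgrPdist_lt : cyb => /(_ (eps / 2)); rewrite divr_gt0 // => /(_ isT).
  by move=> /nbhs_ballP[delta /= d0 H]; exists delta => // u; exact: H.
pose d := Num.min delta (s + h - beta).
have d0 : 0 < d by rewrite lt_min delta0; lra.
have [dd dh] : d <= delta /\ d <= s + h - beta.
  by split; rewrite ge_min lexx ?orbT.
have Fy u : beta <= u -> u < beta + d -> F' (y u) = F (y u).
  move=> bu ud; pose t1 := Num.max s (beta - d / 2).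
  have [t1s t1d] : s <= t1 /\ beta - d / 2 <= t1.
    by split; rewrite /t1 le_max lexx ?orbT.
  have t1b : t1 < beta by rewrite /t1 gt_max; apply/andP; split; lra.
  apply/esym/(FF' t1); first lra.
  rewrite -xy //; have A : `|y beta - y u| < eps / 2.
    by apply: ydelta; rewrite ltr_norml; lra.
  have B : `|y beta - y t1| < eps / 2.
    by apply: ydelta; rewrite ltr_norml; lra.
  have -> : y u - y t1 = (y beta - y t1) - (y beta - y u).
    by rewrite opprB [RHS]addrC subrKA.
  apply: (le_lt_trans (ler_normB _ _)); lra.
pose z t := if t < beta then x t else y t.
have zx t : t < beta -> z t = x t by rewrite /z => ->.
have zy t : s <= t -> z t = y t.
  by move=> st; rewrite /z; case: ifP => // tb; rewrite xy.
exists (beta + d)%:E, z; split; first by rewrite lte_fin; lra.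
  have dz t : t0 < t -> t < beta + d -> is_derive t (1 : R) z (F (z t)).
    move=> t0t td; have [tb|bt] := ltP t beta.
      rewrite (zx t tb); have dxt := dx t t0t ltac:(by rewrite lte_fin).
      apply: near_eq_is_derive dxt; near=> u; rewrite zx //.
      by near: u; exact: lt_nbhsl.
    have st : s < t by lra.
    rewrite (zy t (ltW st)) -Fy //.
    have dyt : is_derive t (1 : R) y (F' (y t)) by apply: dy; rewrite ltr_norml; lra.
    apply: near_eq_is_derive dyt; near=> u; rewrite zy //.
    by apply: ltW; near: u; exact: lt_nbhsr.
  split; first by rewrite lte_fin; lra.
    apply/subspace_continuousP => t [t0t tbd]; rewrite lte_fin in tbd.
    move: t0t; rewrite le_eqVlt => /predU1P[<-|t0t].
      have TI0 : time_interval t0 beta%:E t0 by split=> //; rewrite lte_fin.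
      have /subspace_continuousP/(_ t0 TI0)/cvgrPdist_le cxt := cx.
      apply/cvgrPdist_le => e e0; have := cxt e e0; rewrite /prop_near1 /within /=.
      rewrite !nbhs_simpl /= => cxe.
      have : \forall u \near t0, u < beta by exact: lt_nbhsl.
      apply: filterS2 cxe => u cu ub [t0u _].
      suff : `|z t0 - z u| <= e by [].
      by rewrite !zx //; apply: cu; split=> //; rewrite lte_fin.
    apply: cvg_within_filter.
    exact: is_derive_rV_continuous (dz t t0t tbd).
  by move=> t t0t; rewrite lte_fin => td; exact: dz.
by move=> t [_]; rewrite lte_fin => tb; rewrite zx.
Unshelve. all: by end_near. Qed.

End Continuation.

(** * The oscillators and the rotating frame *)

Section Oscillators.
Context {R : realType} {m : nat}.
Implicit Types (xi eta : 'rV[R]_(m * 2)).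

Lemma ord2P (k : 'I_2) : k = ord0 \/ k = ord_max.
Proof. by case: k => -[|[|//]] k; [left|right]; exact/val_inj. Qed.

Lemma positionE xi i : position xi i = xi ord0 (mxvec_index i ord0).
Proof. by rewrite /position mxE. Qed.

Lemma momentumE xi i : momentum xi i = xi ord0 (mxvec_index i ord_max).
Proof. by rewrite /momentum mxE. Qed.

Definition state_spread xi (S : R) : Prop :=
  spread_le (position xi) S /\ spread_le (momentum xi) S.

Lemma synchronization_manifoldP eta : synchronization_manifold R m eta ->
  forall i j, position eta i = position eta j /\ momentum eta i = momentum eta j.
Proof.
move=> Aeta i j; have /rowP E := Aeta i j.
by have := E ord0; have := E ord_max; rewrite /position /momentum !mxE.
Qed.

Lemma coord_le_eucl_norm n (x : 'rV[R]_n) k : `|x ord0 k| <= eucl_norm x.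
Proof.
rewrite /eucl_norm -sqrtr_sqr ler_wsqrtr // (bigD1 k) //= lerDl.
by apply: sumr_ge0 => *; exact: sqr_ge0.
Qed.

Lemma eucl_norm_ge0 n (x : 'rV[R]_n) : 0 <= eucl_norm x.
Proof. exact: sqrtr_ge0. Qed.

Let distances xi := [set eucl_norm (xi - y) | y in synchronization_manifold R m].

Lemma has_inf_distances xi : has_inf (distances xi).
Proof.
split; last by exists 0 => _ [y _ <-]; exact: eucl_norm_ge0.
exists (eucl_norm (xi - 0)), 0 => //.
by move=> i j; apply/rowP => k; rewrite !mxE.
Qed.

(** The distance is an infimum that need not be attained, hence a point of the
    manifold at a distance less than [2 * r] is used. *)
Lemma state_spread_of_dist xi r : 0 < r ->
  eucl_dist (synchronization_manifold R m) xi <= r -> state_spread xi (4 * r).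
Proof.
move=> r0 xr; have [_ [y Ay <-]] := inf_adherent r0 (has_inf_distances xi).
rewrite -/(eucl_dist _ _) => yr.
have near k : `|xi ord0 k - y ord0 k| <= 2 * r.
  have := coord_le_eucl_norm (xi - y) k; rewrite !mxE; lra.
split=> i j; have [pij mij] := synchronization_manifoldP Ay i j.
  move: pij; rewrite !positionE => pij.
  have := near (mxvec_index i ord0); have := near (mxvec_index j ord0).
  rewrite !ler_norml => /andP[? ?] /andP[? ?]; lra.
move: mij; rewrite !momentumE => mij.
have := near (mxvec_index i ord_max); have := near (mxvec_index j ord_max).
rewrite !ler_norml => /andP[? ?] /andP[? ?]; lra.
Qed.

(** The state with all oscillators equal to number [i0] is close. *)
Lemma dist_of_state_spread xi (i0 : 'I_m) S : 0 <= S -> state_spread xi S ->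
  eucl_dist (synchronization_manifold R m) xi <= (m * 2)%:R * S.
Proof.
move=> S0 [qS pS].
pose y := mxvec (\matrix_(i < m, k < 2) vec_mx xi i0 k).
have Ay : synchronization_manifold R m y.
  by move=> i j; apply/rowP => k; rewrite /y mxvecK !mxE.
apply: (@le_trans _ _ (eucl_norm (xi - y))).
  by apply: ge_inf; [case: (has_inf_distances xi)|exists y].
have coordS k : `|(xi - y) ord0 k| <= S.
  case/mxvec_indexP: k => i k; rewrite 2!mxE /y mxvecE !mxE.
  have [->|->] := ord2P k; rewrite -?positionE -?momentumE.
    exact: (spread_le_norm i0 i qS).
  exact: (spread_le_norm i0 i pS).
have le1 : 1 <= (m * 2)%:R :> R.
  by rewrite ler1n muln_gt0 andbT; exact: leq_ltn_trans (ltn_ord i0).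
rewrite /eucl_norm -[leRHS]ger0_norm ?mulr_ge0 ?ler0n // -sqrtr_sqr ler_wsqrtr //.
apply: (@le_trans _ _ (\sum_(k < m * 2) S ^+ 2)).
  apply: ler_sum => k _; rewrite -[leLHS]real_normK ?num_real //.
  by rewrite lerXn2r // nnegrE.
rewrite sumr_const card_ord -[leLHS]mulr_natl exprMn ler_wpM2r ?sqr_ge0 //.
by rewrite expr2 ler_peMl // ler0n.
Qed.

(** If two coordinates of a limit point differed, points of the manifold closer than
    half of the difference would have different coordinates as well. *)
Lemma synchronization_manifold_closed : closed (synchronization_manifold R m).
Proof.
move=> xi clxi i j; apply/rowP => k; rewrite !mxE; apply/eqP; apply: contrapT => ne.
set u := xi ord0 _ in ne; set v := xi ord0 _ in ne.
have e0 : 0 < `|u - v| / 2.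
  by rewrite divr_gt0 // normr_gt0 subr_eq0; apply/negP.
have [y [Ay]] := clxi _ (nbhsx_ballx xi _ e0).
rewrite -ball_normE /= => yxi.
have cu := le_lt_trans (rV_coord_le (xi - y) (mxvec_index i k)) yxi.
have cv := le_lt_trans (rV_coord_le (xi - y) (mxvec_index j k)) yxi.
have yE : y ord0 (mxvec_index i k) = y ord0 (mxvec_index j k).
  by have /rowP/(_ k) := Ay i j; rewrite !mxE.
rewrite !mxE -/u yE in cu; rewrite !mxE -/v in cv.
have := ler_normB (u - y ord0 (mxvec_index i k)) (v - y ord0 (mxvec_index j k)).
rewrite yE opprB subrKA; lra.
Qed.

Variable gamma : 'I_m -> 'I_m -> R -> R.
Hypothesis hlip : forall i j : 'I_m, i != j -> locally_lipschitz (gamma i j).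
Variable omega : R.
Hypothesis omega0 : 0 < omega.

(** Saturation turns local into global Lipschitz continuity without changing the
    field where the relative momenta are at most [M]. *)
Definition saturated_coupling (M : R) i j (s : R) : R := gamma i j (clip (- M) M s).

Lemma saturated_field_lipschitz (M : R) : 0 <= M -> exists2 K, 0 < K &
  forall y z, `|coupled_oscillators (saturated_coupling M) y omega 0
              - coupled_oscillators (saturated_coupling M) z omega 0| <= K * `|y - z|.
Proof.
move=> M0; have [L L0 gL] := common_lipschitz_constant hlip M0.
exists (omega + m%:R * (L * 2)).
  by rewrite ltr_pwDl // !mulr_ge0 // ?ler0n // ltW.
move=> y z; have yz0 := normr_ge0 (y - z).
have L20 : 0 <= m%:R * (L * 2) by rewrite !mulr_ge0 // ?ler0n // ltW.
have K0 : 0 <= omega + m%:R * (L * 2) by rewrite addr_ge0 // ltW.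
have dp i : `|momentum y i - momentum z i| <= `|y - z|.
  by have := rV_coord_le (y - z) (mxvec_index i ord_max); rewrite !mxE -!momentumE.
have dq i : `|position y i - position z i| <= `|y - z|.
  by have := rV_coord_le (y - z) (mxvec_index i ord0); rewrite !mxE -!positionE.
apply: rV_norm_le => [|k]; first by rewrite mulr_ge0.
case/mxvec_indexP: k => i k; rewrite mxE [X in _ + X]mxE !mxvecE !mxE.
case: ifP => _.
  rewrite -mulrBr normrM gtr0_norm // mulrDl -[leLHS]addr0.
  by apply: lerD; [rewrite ler_wpM2l ?dp // ltW|rewrite mulr_ge0].
have -> : forall a b c d : R, - a + b - (- c + d) = (b - d) - (a - c).
  by move=> *; ring.
rewrite -mulrBr -sumrB (le_trans (ler_normB _ _)) // addrC mulrDl; apply: lerD.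
  by rewrite normrM gtr0_norm // ler_wpM2l ?dq // ltW.
apply: (le_trans (ler_norm_sum _ _ _)); rewrite -mulrA; apply: sum_others_le.
  by rewrite !mulr_ge0 // ltW.
move=> j ji; rewrite eq_sym in ji.
have cM (s : R) : `|clip (- M) M s| <= M.
  by rewrite ler_norml; apply: clip_itv; lra.
apply: (le_trans (gL i j ji _ _ (cM _) (cM _))).
rewrite -mulrA ler_wpM2l ?(ltW L0) //; apply: (le_trans (clip_dist _ _ _ _)).
have -> : forall a b c d : R, a - b - (c - d) = (a - c) - (b - d).
  by move=> *; ring.
by apply: (le_trans (ler_normB _ _)); have := dp i; have := dp j; lra.
Qed.

Lemma saturated_field_eq (M : R) y : (forall i j, `|momentum y j - momentum y i| <= M) ->
  coupled_oscillators gamma y omega 0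
  = coupled_oscillators (saturated_coupling M) y omega 0.
Proof.
move=> yM; rewrite /coupled_oscillators; congr mxvec; apply/matrixP => i k.
rewrite !mxE; case: ifP => // _; congr (_ + _); apply: eq_bigr => j ji.
by rewrite /saturated_coupling clip_id // -ler_norml.
Qed.

Definition rotated_q (x : R -> 'rV[R]_(m * 2)) i t : R :=
  cos (omega * t) * position (x t) i - sin (omega * t) * momentum (x t) i.
Definition rotated_p (x : R -> 'rV[R]_(m * 2)) i t : R :=
  sin (omega * t) * position (x t) i + cos (omega * t) * momentum (x t) i.

(** The couplings only see relative momenta, which are projections in the rotating
    frame. *)
Lemma rotated_projection x i j t :
  projection omega (rotated_q x j t - rotated_q x i t)
    (rotated_p x j t - rotated_p x i t) t = momentum (x t) j - momentum (x t) i.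
Proof.
rewrite /projection /rotated_q /rotated_p.
rewrite -[RHS]mul1r -(cos2Dsin2 (omega * t)); ring.
Qed.

Lemma rotated_position x i t :
  position (x t) i = cos (omega * t) * rotated_q x i t + sin (omega * t) * rotated_p x i t.
Proof.
by rewrite /rotated_q /rotated_p -[LHS]mul1r -(cos2Dsin2 (omega * t)); ring.
Qed.

Lemma rotated_momentum x i t :
  momentum (x t) i = cos (omega * t) * rotated_p x i t - sin (omega * t) * rotated_q x i t.
Proof.
by rewrite /rotated_q /rotated_p -[LHS]mul1r -(cos2Dsin2 (omega * t)); ring.
Qed.

Lemma cos_sin_combination_le (u v S theta : R) : `|u| <= S -> `|v| <= S ->
  cos theta * u + sin theta * v <= 2 * S /\ cos theta * u - sin theta * v <= 2 * S.
Proof.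
move=> uS vS.
have cu : `|cos theta * u| <= S.
  by apply: le_trans uS; rewrite normrM ler_piMl // ler_norml cos_geN1 cos_le1.
have sv : `|sin theta * v| <= S.
  by apply: le_trans vS; rewrite normrM ler_piMl // ler_norml sin_geN1 sin_le1.
move: cu sv; rewrite !ler_norml => /andP[? ?] /andP[? ?]; lra.
Qed.

Lemma rotated_spread x t S : state_spread (x t) S ->
  spread_le ((rotated_q x)^~ t) (2 * S) /\ spread_le ((rotated_p x)^~ t) (2 * S).
Proof.
move=> [qS pS]; split=> i j; have q := spread_le_norm j i qS;
  have p := spread_le_norm j i pS.
  have [_] := cos_sin_combination_le (omega * t) q p.
  by rewrite /rotated_q; apply: le_trans; rewrite le_eqVlt; apply/orP; left; apply/eqP; ring.
have [+ _] := cos_sin_combination_le (omega * t) p q.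
by rewrite /rotated_p; apply: le_trans; rewrite le_eqVlt; apply/orP; left; apply/eqP; ring.
Qed.

Lemma state_spread_of_rotated x t S :
  spread_le ((rotated_q x)^~ t) S -> spread_le ((rotated_p x)^~ t) S ->
  state_spread (x t) (2 * S).
Proof.
move=> aS bS; split=> i j; have a := spread_le_norm j i aS;
  have b := spread_le_norm j i bS.
  have [+ _] := cos_sin_combination_le (omega * t) a b.
  rewrite !rotated_position; apply: le_trans.
  by rewrite le_eqVlt; apply/orP; left; apply/eqP; ring.
have [_] := cos_sin_combination_le (omega * t) b a.
rewrite !rotated_momentum; apply: le_trans.
by rewrite le_eqVlt; apply/orP; left; apply/eqP; ring.
Qed.

Lemma rotated_continuous x t i : {for t, continuous x} ->
  {for t, continuous (rotated_q x i)} /\ {for t, continuous (rotated_p x i)}.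
Proof.
move=> cx.
have cc k : {for t, continuous (fun u => x u ord0 k)}.
  apply: (@continuous_comp _ _ _ x (fun u : 'rV_(m * 2) => u ord0 k)) => //.
  exact: coord_continuous.
have cq : {for t, continuous (fun u => position (x u) i)}.
  by rewrite (_ : (fun u => _) = (fun u => x u ord0 (mxvec_index i ord0))) //;
    apply/funext => u; exact: positionE.
have cp : {for t, continuous (fun u => momentum (x u) i)}.
  by rewrite (_ : (fun u => _) = (fun u => x u ord0 (mxvec_index i ord_max))) //;
    apply/funext => u; exact: momentumE.
have cs := is_derive1_continuous (is_derive_sin_omega omega t).
have cco := is_derive1_continuous (is_derive_cos_omega omega t).
split; first by apply: cvgB; apply: cvgM.
by apply: cvgD; apply: cvgM.
Qed.

Lemma rotated_solution (t0 s : R) x : 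
    (forall t, t0 <= t <= s -> {for t, continuous x}) ->
    (forall t, t0 < t < s ->
      is_derive t (1 : R) x (coupled_oscillators gamma (x t) omega t)) ->
  rotating_solution gamma omega t0 s (rotated_q x) (rotated_p x).
Proof.
move=> cx dx.
have inputE i t : coupling_input gamma omega (rotated_q x) (rotated_p x) i t
    = \sum_(j < m | j != i) gamma i j (momentum (x t) j - momentum (x t) i).
  by apply: eq_bigr => j _; rewrite rotated_projection.
have dqp i t : t0 < t < s ->
  is_derive t (1 : R) (fun t => position (x t) i) (omega * momentum (x t) i) /\
  is_derive t (1 : R) (fun t => momentum (x t) i) (- (omega * position (x t) i)
    + coupling_input gamma omega (rotated_q x) (rotated_p x) i t).
  move=> ts; split.
    have := is_derive_rV_coord (mxvec_index i ord0) (dx t ts).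
    rewrite /coupled_oscillators mxvecE mxE eqxx.
    by under eq_fun do rewrite -positionE.
  have := is_derive_rV_coord (mxvec_index i ord_max) (dx t ts).
  rewrite /coupled_oscillators mxvecE mxE /= -inputE.
  by under eq_fun do rewrite -momentumE.
split=> i t ts.
- by have [] := rotated_continuous i (cx t ts).
- by have [] := rotated_continuous i (cx t ts).
- have [dq dp] := dqp i t ts.
  have := is_derive_fctB (is_derive_fctM (is_derive_cos_omega omega t) dq)
    (is_derive_fctM (is_derive_sin_omega omega t) dp).
  by move=> d; apply: (is_derive_eq d); ring.
- have [dq dp] := dqp i t ts.
  have := is_derive_fctD (is_derive_fctM (is_derive_sin_omega omega t) dq)
    (is_derive_fctM (is_derive_cos_omega omega t) dp).
  by move=> d; apply: (is_derive_eq d); ring.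
Qed.

End Oscillators.

(** * Global solutions and stability *)

Section SpreadContinuity.
Context {R : realType} {m : nat}.
Variables (a : 'I_m -> R -> R) (t : R).
Hypothesis ca : forall i, {for t, continuous (a i)}.

Lemma spread_lt_near S D : spread_le (a^~ t) S -> S < D ->
  \forall u \near t, spread_le (a^~ u) D.
Proof.
move=> aS SD.
have near_ij i j : \forall u \near t, a i u - a j u <= D.
  have cij : {for t, continuous (fun u => a i u - a j u)} by apply: cvgB; exact: ca.
  near=> u; apply: ltW; near: u; move: cij => /cvgr_lt; apply.
  exact: le_lt_trans (aS i j) SD.
have H : \forall u \near t, forall i j, a i u - a j u <= D.
  apply: (@filter_forall R _ (fun i u => forall j, a i u - a j u <= D) (nbhs t) _) => i.
  apply: (@filter_forall R _ (fun j u => a i u - a j u <= D) (nbhs t) _) => j.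
  exact: near_ij.
exact: H.
Unshelve. all: by end_near. Qed.

Lemma spread_le_left_limit (t0 D : R) : t0 < t ->
  (forall u, t0 <= u < t -> spread_le (a^~ u) D) -> spread_le (a^~ t) D.
Proof.
move=> t0t uD i j; rewrite leNgt; apply/negP => Dt.
have cij : {for t, continuous (fun u => a i u - a j u)} by apply: cvgB; exact: ca.
have /nbhs_ballP[e /= e0 eD] : \forall u \near t, D < a i u - a j u.
  by move: cij => /cvgr_gt; apply.
pose u := Num.max t0 (t - e / 2).
have u1 : t0 <= u by rewrite le_max lexx.
have u2 : t - e / 2 <= u by rewrite le_max lexx orbT.
have u3 : u < t by rewrite gt_max t0t /=; lra.
have : D < a i u - a j u by apply: eD; rewrite /ball /= ltr_norml; lra.
by rewrite ltNge uD // u1.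
Qed.

End SpreadContinuity.

Section Trapping.
Context {R : realType} {m : nat}.
Variable gamma : 'I_m -> 'I_m -> R -> R.
Hypothesis hlip : forall i j : 'I_m, i != j -> locally_lipschitz (gamma i j).
Variables (omega B d T : R).
Hypotheses (omega0 : 0 < omega) (d0 : 0 < d).
Hypothesis contraction : forall (t0 s : R) (a b : 'I_m -> R -> R), t0 <= s ->
    rotating_solution gamma omega t0 s a b ->
    (forall t, t0 <= t <= s -> spread_le (a^~ t) (B + 2 * d)) ->
    (forall t, t0 <= t <= s -> spread_le (b^~ t) (B + 2 * d)) ->
    forall S, d <= S -> S <= B -> spread_le (a^~ t0) S -> spread_le (b^~ t0) S ->
    (spread_le (a^~ s) (S + d) /\ spread_le (b^~ s) (S + d)) /\
    (t0 + T <= s -> spread_le (a^~ s) (2 * d) /\ spread_le (b^~ s) (2 * d)).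

Let f (xi : 'rV[R]_(m * 2)) (t : R) := coupled_oscillators gamma xi omega t.

(** The estimates of [rotating_spread] need the a priori bound [B + 2 * d] and yield
    the bound [S + d], which is smaller; real induction removes the assumption. *)
Lemma solution_trapped (t0 : R) (b : \bar R) x (S : R) : solution f t0 b x ->
    d <= S -> S <= B ->
    spread_le ((rotated_q omega x)^~ t0) S -> spread_le ((rotated_p omega x)^~ t0) S ->
  forall t, t0 <= t -> (t%:E < b)%E ->
    (spread_le ((rotated_q omega x)^~ t) (S + d) /\
     spread_le ((rotated_p omega x)^~ t) (S + d)) /\
    (t0 + T <= t -> spread_le ((rotated_q omega x)^~ t) (2 * d) /\
                    spread_le ((rotated_p omega x)^~ t) (2 * d)).
Proof.
move=> sol dS SB qS pS t1 t01 t1b; have d_gt0 := d0.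
pose x' t := x (Num.max t0 t).
have [cx' dx'] : (forall t : R, (t%:E < b)%E -> {for t, continuous x'}) /\
    (forall t : R, t0 < t -> (t%:E < b)%E -> is_derive t (1 : R) x' (f (x' t) t)).
  exact: solution_frozen_before sol.
have xE t : t0 <= t -> x' t = x t by move=> t0t; rewrite /x' max_r.
have qE t i : t0 <= t -> rotated_q omega x' i t = rotated_q omega x i t.
  by move=> t0t; rewrite /rotated_q xE.
have pE t i : t0 <= t -> rotated_p omega x' i t = rotated_p omega x i t.
  by move=> t0t; rewrite /rotated_p xE.
have ltb t : t <= t1 -> (t%:E < b)%E.
  by move=> tt1; apply: le_lt_trans t1b; rewrite lee_fin.
have qS' : spread_le ((rotated_q omega x')^~ t0) S by move=> i j; rewrite !qE.
have pS' : spread_le ((rotated_p omega x')^~ t0) S by move=> i j; rewrite !pE.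
have cq i t : t <= t1 -> {for t, continuous (rotated_q omega x' i)}.
  by move=> /ltb/cx'/(rotated_continuous omega i)[].
have cp i t : t <= t1 -> {for t, continuous (rotated_p omega x' i)}.
  by move=> /ltb/cx'/(rotated_continuous omega i)[].
pose D := B + 2 * d.
pose P t := spread_le ((rotated_q omega x')^~ t) D /\
            spread_le ((rotated_p omega x')^~ t) D.
have upto t : t0 <= t <= t1 -> (forall u, t0 <= u <= t -> P u) ->
    (spread_le ((rotated_q omega x')^~ t) (S + d) /\
     spread_le ((rotated_p omega x')^~ t) (S + d)) /\
    (t0 + T <= t -> spread_le ((rotated_q omega x')^~ t) (2 * d) /\
                    spread_le ((rotated_p omega x')^~ t) (2 * d)).
  move=> /andP[t0t tt1] Pt; apply: contraction => //.
  - apply: rotated_solution => u /andP[t0u ut].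
      by apply: cx'; apply: ltb; lra.
    by apply: dx' => //; apply: ltb; lra.
  - by move=> u /Pt[].
  - by move=> u /Pt[].
have PS u : spread_le ((rotated_q omega x')^~ u) (S + d) ->
    spread_le ((rotated_p omega x')^~ u) (S + d) -> P u.
  have SdD : S + d <= D by rewrite /D; lra.
  by move=> q p; split=> i j; [apply: le_trans (q i j) _|apply: le_trans (p i j) _].
have Pall : forall t, t0 <= t <= t1 -> P t.
  apply: real_induction => t /andP[t0t tt1] Pbefore.
  have Pt : P t.
    move: t0t; rewrite le_eqVlt => /predU1P[<-|t0t].
      have SD : S <= D by rewrite /D; lra.
      by split=> i j; [apply: le_trans (qS' i j) _|apply: le_trans (pS' i j) _].
    split; apply: (@spread_le_left_limit _ _ _ t _ t0) => // [i|u ut].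
    - exact: cq.
    - by have [] := Pbefore u ut.
    - exact: cp.
    - by have [] := Pbefore u ut.
  have Pupto u : t0 <= u <= t -> P u.
    rewrite [u <= t]le_eqVlt => /andP[t0u /predU1P[->//|ut]].
    by apply: Pbefore; rewrite t0u.
  have [|[q p] _] := upto t _ Pupto; first by rewrite t0t.
  have SD : S + d < D by rewrite /D; lra.
  have nq := spread_lt_near (fun i => cq i t tt1) q SD.
  have np := spread_lt_near (fun i => cp i t tt1) p SD.
  have /nbhs_ballP[e /= e0 eP] : \forall u \near t, P u.
    by apply: filterS2 nq np => u; split.
  exists e => // u /andP[tu ute] _; apply: eP.
  by rewrite /ball /= ltr_norml; lra.
have t1' : t0 <= t1 <= t1 by rewrite t01 lexx.
have [|[q p] late] := upto t1 t1'.
  by move=> u ut; exact: Pall.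
split.
  by split=> i j; [rewrite -!qE|rewrite -!pE].
by move=> /late[q' p']; split=> i j; [rewrite -!qE|rewrite -!pE].
Qed.

(** Along a trapped solution the relative momenta are at most [2 * (S + d)], with a
    margin on which the saturated field agrees with the original one. *)
Lemma maximal_solution_global (t0 : R) (b : \bar R) x (S : R) :
    maximal_solution f t0 b x ->
    d <= S -> S <= B ->
    spread_le ((rotated_q omega x)^~ t0) S -> spread_le ((rotated_p omega x)^~ t0) S ->
  b = +oo%E.
Proof.
move=> [sol nmax] dS SB qS pS; have d_gt0 := d0.
case: b sol nmax => [beta| |] // sol nmax; last by case: sol; rewrite ltNge leNye.
exfalso; apply: nmax.
have trap := solution_trapped sol dS SB qS pS.
(* The additional 1 covers the states within 1 / 2 of the solution. *)
pose M := 2 * (S + d) + 1.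
have M0 : 0 <= M by rewrite /M; lra.
have [K K0 FK] := saturated_field_lipschitz hlip omega0 M0.
apply: (@solution_extends _ _ (fun y => coupled_oscillators gamma y omega 0) _
  K 2^-1 t0 beta x K0 FK) => //.
move=> t z /andP[t0t tb] zx; apply: saturated_field_eq => i j.
have [|[q p] _] := trap t t0t; first by rewrite lte_fin.
have := projection_norm_le omega (rotated_q omega x j t - rotated_q omega x i t)
  (rotated_p omega x j t - rotated_p omega x i t) t.
rewrite rotated_projection.
have := spread_le_norm i j q; have := spread_le_norm i j p.
have near k : `|momentum z k - momentum (x t) k| < 2^-1.
  apply: le_lt_trans zx; have := rV_coord_le (z - x t) (mxvec_index k ord_max).
  by rewrite !mxE -!momentumE.
have := ler_normD (momentum (x t) j - momentum (x t) i)
  ((momentum z j - momentum (x t) j) - (momentum z i - momentum (x t) i)).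
have := ler_normB (momentum z j - momentum (x t) j) (momentum z i - momentum (x t) i).
have -> : momentum (x t) j - momentum (x t) i
  + ((momentum z j - momentum (x t) j) - (momentum z i - momentum (x t) i))
  = momentum z j - momentum z i by ring.
have := near i; have := near j; rewrite /M; lra.
Qed.

End Trapping.

(** The spread threshold [d] comes from the factor [2 * (m * 2)] between the spread
    in the rotating frame and the distance, and the final spread [2 * d]; [B] comes
    from the factor [8] in the opposite direction. *)
Theorem theorem8 (R : realType) (m : nat) (gamma : 'I_m -> 'I_m -> R -> R)
    (hm : (2 <= m)%N)
    (hgamma : interconnection gamma)
    (hconn : connected_interconnection gamma)
    (hlip : forall i j : 'I_m, i != j -> locally_lipschitz (gamma i j)) :
  semiglobally_practically_asymptotically_stable
    (coupled_oscillators gamma) (synchronization_manifold R m).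
Proof.
split=> [|Delta delta Delta0 delta0]; first exact: synchronization_manifold_closed.
have [i0 _] := hconn.
have m2 : 0 < (m * 2)%:R :> R.
  by rewrite ltr0n muln_gt0 andbT; exact: ltnW.
pose d := delta / (4 * (m * 2)%:R).
have d0 : 0 < d by rewrite divr_gt0 // mulr_gt0.
have dE : d * (4 * (m * 2)%:R) = delta by rewrite divfK // gt_eqF // mulr_gt0.
pose B := 8 * Delta + d.
have dB : d <= B by rewrite /B; lra.
have [os os0 Hos] := rotating_spread hgamma hconn hlip d0 dB.
exists os => // omega oo; have omega0 : 0 < omega := lt_le_trans os0 oo.
have [T T0 contraction] := Hos omega oo.
pose f (xi : 'rV[R]_(m * 2)) (t : R) := coupled_oscillators gamma xi omega t.
have trapped (r S : R) : 0 < r -> 8 * r <= S -> d <= S -> S <= B ->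
    (forall c, (m * 2)%:R * (2 * (S + d)) <= c ->
       confined_after f (synchronization_manifold R m) r c 0) /\
    (forall c, delta <= c ->
       confined_after f (synchronization_manifold R m) r c T).
  move=> r0 rS dS SB.
  suff H (t0 : R) (b : \bar R) x : maximal_solution f t0 b x ->
      eucl_dist (synchronization_manifold R m) (x t0) <= r ->
      b = +oo%E /\ forall t, t0 <= t ->
      eucl_dist (synchronization_manifold R m) (x t) <= (m * 2)%:R * (2 * (S + d)) /\
      (t0 + T <= t -> eucl_dist (synchronization_manifold R m) (x t) <= delta).
    split=> c cle t0 b x xmax x0r t t0t; have [-> Ht] := H t0 b x xmax x0r;
      rewrite ltry; split=> //.
      by rewrite addr0 in t0t; have [Hd _] := Ht t t0t; exact: le_trans cle.
    have t0t' : t0 <= t by apply: le_trans t0t; rewrite lerDl ltW.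
    by have [_ Hd] := Ht t t0t'; exact: le_trans (Hd t0t) cle.
  move=> xmax x0r; have := rotated_spread omega (state_spread_of_dist r0 x0r).
  move=> [q8 p8].
  have qS : spread_le ((rotated_q omega x)^~ t0) S.
    by move=> i j; apply: le_trans (q8 i j) _; lra.
  have pS : spread_le ((rotated_p omega x)^~ t0) S.
    by move=> i j; apply: le_trans (p8 i j) _; lra.
  have bE := maximal_solution_global hlip omega0 d0 contraction xmax dS SB qS pS.
  split=> // t t0t; have tb : (t%:E < b)%E by rewrite bE ltry.
  have [[q p] late] := solution_trapped d0 contraction xmax.1 dS SB qS pS t0t tb.
  split.
    apply: (dist_of_state_spread i0); last exact: state_spread_of_rotated.
    by rewrite mulr_ge0 //; lra.
  move=> /late[q' p'].
  have := dist_of_state_spread i0 _ (state_spread_of_rotated q' p').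
  have -> : (m * 2)%:R * (2 * (2 * d)) = delta by rewrite -dE; ring.
  by apply; rewrite !mulr_ge0 // ltW.
have deltaE : (m * 2)%:R * (2 * (d + d)) = delta by rewrite -dE; ring.
have confinedW r r' c t : r' <= r ->
    confined_after f (synchronization_manifold R m) r c t ->
    confined_after f (synchronization_manifold R m) r' c t.
  by move=> rr H t0 b x xmax xr; apply: (H t0 b x xmax); exact: le_trans rr.
have d80 : 0 < d / 8 by rewrite divr_gt0.
split=> [r dr|eps epsD|r eps rD deps].
- exists (d / 8) => //; have [| | |H _] := trapped (d / 8) d d80 => //; first lra.
  by apply: H; rewrite deltaE ltW.
- exists ((m * 2)%:R * (2 * (B + d))).
    by rewrite mulr_gt0 //; lra.
  have [| |//|H _] := trapped Delta B Delta0 => //; first by rewrite /B; lra.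
  by apply: confinedW (ltW epsD) _; exact: H.
- exists T => //; have [| |//|_ H] := trapped Delta B Delta0 => //.
    by rewrite /B; lra.
  by apply: confinedW (ltW rD) _; apply: H; exact: ltW.
Qed.
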